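(* Let $\wedge_2\mathbb{R}^n=\{A\in\mathbb{R}^{n\times n}: a_{ij}+a_{ji}=0 \text{ for all } i,j\}$ be the space of skew-symmetric matrices. The open cones in $\wedge_2\mathbb{R}^n$ on which the tropical eigenpair map for skew-symmetric matrices is represented by distinct and unique linear functions are the (relative interiors of the) cones $\Omega_\phi\cap\wedge_2\mathbb{R}^n$, where $\phi$ runs over all kites on $[n]$. Each such cone has $n(n-3)$ facets, so it is not simplicial, but it is linearly isomorphic to $\mathbb{R}^{n-1}$ times the cone over the standard cube of dimension $n(n-3)/2=\binom{n}{2}-n$. This collection of cones does not form a fan for $n\ge 6$.
   Context: Max-plus arithmetic: $u\oplus v=\max\{u,v\}$, $u\odot v=u+v$. A tropical eigenpair of $A\in\mathbb{R}^{n\times n}$ is $(\lambda,x)\in\mathbb{R}\times\mathbb{R}^n$ with $\max_j(a_{ij}+x_j)=\lambda+x_i$ for all $i$; eigenvectors are taken in $\mathbb{TP}^{n-1}=\mathbb{R}^n/\mathbb{R}(1,\dots,1)$, the eigenvalue $\lambda(A)$ is unique (maximum cycle mean of the complete weighted digraph on $[n]$ with loops), and for generic $A$ the eigenvector $x(A)$ is unique. A function $\phi:[n]\to[n]$ is connected if its graph (edges $i\to\phi(i)$) is connected as an undirected graph; it then has a unique cycle. A kite is a connected function whose cycle has length at least $3$. For a generic matrix $A$ (unique cycle of maximal mean, the critical cycle, and for every vertex $i$ and every critical vertex $\ell$ a unique simple directed path from $i$ to $\ell$ of maximal total weight w.r.t. weights $a_{ij}-\lambda(A)$), the critical graph of $A$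 consists of the critical cycle together with, for each non-critical vertex $i$, the edges of the maximal path from $i$ to the unique critical vertex $i^\ast$ for which this path avoids the edges of the critical cycle; it is the graph of a connected function. For a connected function $\phi$, $\Omega_\phi\subseteq\mathbb{R}^{n\times n}$ is the closure of the set of generic matrices with critical graph $\phi$; it is a convex polyhedral cone on which the eigenpair map is linear.
   Formalization: Stated for n ≥ 3 (for n = 1, 2 there are no kites but the eigenpair map is linear on the whole space), and the facet count and non-simpliciality only for n ≥ 4 (for n = 3 each cone is a half-space, which has one facet and is simplicial). *)

(* Defs.v *)
From HB Require Import structures.
From mathcomp Require Import all_boot all_order all_algebra.
From mathcomp Require Import all_classical all_reals all_analysis.

Set Implicit Arguments.
Unset Strict Implicit.
Unset Printing Implicit Defensive.

Import Order.TTheory GRing.Theory Num.Theory.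
Import numFieldNormedType.Exports.

Local Open Scope classical_set_scope.
Local Open Scope ring_scope.

Section Polyhedral.
Context {R : realType}.

Section Lmodule.
Context {V : lmodType R}.

Definition convex_cone (C : set V) : Prop :=
  (forall (a : R) v, 0 < a -> C v -> C (a *: v)) /\
  (forall v w, C v -> C w -> C (v + w)).

Definition polyhedral_cone (C : set V) : Prop :=
  exists (k : nat) (l : 'I_k -> {linear V -> R^o}),
    C = [set v | forall i, 0 <= l i v].

(* The functional l = 0 is allowed, so that a cone is a face of itself. *)
Definition face (C F : set V) : Prop :=
  exists l : {linear V -> R^o},
    (forall v, C v -> 0 <= l v) /\ F = [set v | C v /\ l v = 0].

Definition fan (S : set (set V)) : Prop :=
  [/\ finite_set S,
      (forall C, S C -> polyhedral_cone C),
      (forall C F, S C -> face C F -> S F) &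
      (forall C D, S C -> S D -> face C (C `&` D) /\ face D (C `&` D))].

Definition all_faces (S : set (set V)) : set (set V) :=
  [set F | exists2 C, S C & face C F].

Definition affine_hull (C : set V) : set V :=
  [set v | exists (k : nat) (c : 'I_k -> R) (p : 'I_k -> V),
    [/\ forall i, C (p i), \sum_i c i = 1 & v = \sum_i c i *: p i]].

End Lmodule.

Section Vector.
Context {V : vectType R}.

Definition linear_span (S : set V) (W : {vspace V}) : Prop :=
  (forall v, S v -> v \in W) /\
  (forall W' : {vspace V}, (forall v, S v -> v \in W') -> (W <= W')%VS).

(* Cones contain 0, so their dimension is that of their linear span. *)
Definition facet (C F : set V) : Prop :=
  face C F /\
  exists WC WF : {vspace V},
    [/\ linear_span C WC, linear_span F WF & \dim WC = (\dim WF).+1].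

(* Cones may have a nontrivial lineality space L: simplicial means linearly
   isomorphic to L x (R_{>=0})^k. *)
Definition simplicial_cone (C : set V) : Prop :=
  exists (L : {vspace V}) (k : nat) (s : k.-tuple V),
    [/\ free s, (L :&: span s)%VS = 0%VS &
        C = [set v | exists2 u, u \in L &
               exists2 c : 'I_k -> R, (forall i, 0 <= c i) &
                 v = u + \sum_(i < k) c i *: tnth s i]].

End Vector.

Definition standard_cube (m : nat) : set 'rV[R]_m :=
  [set p | forall i, -1 <= p 0 i <= 1].

Definition cone_over (m : nat) (P : set 'rV[R]_m) : set (R^o * 'rV[R]_m)%type :=
  [set q | exists (t : R) (p : 'rV[R]_m), [/\ 0 <= t, P p & q = (t, t *: p)]].

End Polyhedral.

Section Functions.
Context {n : nat}.
Implicit Type phi : {ffun 'I_n -> 'I_n}.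

Definition connected_function phi : Prop :=
  forall i j, connect [rel u v | (phi u == v) || (phi v == u)] i j.

Definition kite phi : Prop :=
  connected_function phi /\
  exists c : seq 'I_n, ufcycle phi c /\ (3 <= size c)%N.

End Functions.

Section Tropical.
Context {R : realType} {n : nat}.
Implicit Types (A : 'M[R]_n) (x y : 'cV[R]_n) (phi : {ffun 'I_n -> 'I_n}).

(* max_j (a_ij + x_j) = lam + x_i for all i; the maximum is seeded with its
   own term j = i. *)
Definition eigenpair A (lam : R) x : Prop :=
  forall i, \big[Num.max/(A i i + x i 0)]_(j < n) (A i j + x j 0) = lam + x i 0.

(* equality in TP^(n-1) = R^n / R(1,...,1) *)
Definition tp_eq x y : Prop := exists c : R, x = y + const_mx c.

Definition unique_eigenpair A (lam : R) x : Prop :=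
  eigenpair A lam x /\
  forall mu y, eigenpair A mu y -> mu = lam /\ tp_eq y x.

(* A cycle is the sequence of its distinct vertices in cyclic order; sequences
   that differ by a rotation are the same cycle. *)
Definition simple_cycle (c : seq 'I_n) : Prop := c <> [::] /\ uniq c.

Definition cycle_edges (c : seq 'I_n) : seq ('I_n * 'I_n) :=
  [seq (i, next c i) | i <- c].

Definition cycle_mean A (c : seq 'I_n) : R :=
  (\sum_(e <- cycle_edges c) A e.1 e.2) / (size c)%:R.

Definition trop_eigenvalue A : R := sup [set cycle_mean A c | c in simple_cycle].

Definition critical_cycle A (c : seq 'I_n) : Prop :=
  simple_cycle c /\
  forall c', simple_cycle c' -> cycle_mean A c' <= cycle_mean A c.

(* The path from i with vertices i :: p. *)
Definition path_edges (i : 'I_n) (p : seq 'I_n) : seq ('I_n * 'I_n) :=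
  zip (belast i p) p.

Definition simple_path (i l : 'I_n) (p : seq 'I_n) : Prop :=
  uniq (i :: p) /\ last i p = l.

Definition path_weight A (i : 'I_n) (p : seq 'I_n) : R :=
  \sum_(e <- path_edges i p) (A e.1 e.2 - trop_eigenvalue A).

Definition maximal_path A (i l : 'I_n) (p : seq 'I_n) : Prop :=
  simple_path i l p /\
  forall q, simple_path i l q -> path_weight A i q <= path_weight A i p.

Definition generic A : Prop :=
  exists c, [/\ critical_cycle A c,
    (forall c', critical_cycle A c' -> exists k, c' = rot k c) &
    (forall i l, l \in c -> exists! p, maximal_path A i l p)].

Definition critical_edge A (i j : 'I_n) : Prop :=
  exists2 c, critical_cycle A c &
    (i, j) \in cycle_edges c \/
    exists (v l : 'I_n) (p : seq 'I_n),
      [/\ v \notin c, l \in c, maximal_path A v l p,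
          {in path_edges v p, forall e, e \notin cycle_edges c} &
          (i, j) \in path_edges v p].

Definition critical_graph A phi : Prop :=
  forall i j, critical_edge A i j <-> phi i = j.

Definition Omega phi : set 'M[R]_n :=
  closure [set A | generic A /\ critical_graph A phi].

Definition skew_symmetric : set 'M[R]_n := [set A | forall i j, A i j + A j i = 0].

Definition skew_cone phi : set 'M[R]_n := Omega phi `&` skew_symmetric.

Definition relint (C : set 'M[R]_n) : set 'M[R]_n :=
  [set A | C A /\ \forall B \near A, affine_hull C B -> C B].

Definition open_in_skew (U : set 'M[R]_n) : Prop :=
  exists2 W : set 'M[R]_n, open W & U = W `&` skew_symmetric.

(* Maps from the skew-symmetric matrices to R x TP^(n-1) are given by lifts to
   R x R^n; values outside that space are irrelevant. *)
Definition skew_linear (f : 'M[R]_n -> R * 'cV[R]_n) : Prop :=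
  forall (a : R) A B, skew_symmetric A -> skew_symmetric B ->
    (f (a *: A + B)).1 = a * (f A).1 + (f B).1 /\
    tp_eq (f (a *: A + B)).2 (a *: (f A).2 + (f B).2).

Definition skew_map_eq (f g : 'M[R]_n -> R * 'cV[R]_n) : Prop :=
  forall A, skew_symmetric A -> (f A).1 = (g A).1 /\ tp_eq (f A).2 (g A).2.

Definition linear_representation (U : set 'M[R]_n)
    (f : 'M[R]_n -> R * 'cV[R]_n) : Prop :=
  skew_linear f /\ forall A, U A -> unique_eigenpair A (f A).1 (f A).2.

Definition linearity_cone (U : set 'M[R]_n) : Prop :=
  [/\ U !=set0, open_in_skew U, convex_cone U &
      exists f, linear_representation U f].

Definition maximal_linearity_cone (U : set 'M[R]_n) : Prop :=
  linearity_cone U /\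
  forall U', linearity_cone U' -> U `<=` U' -> U' = U.

Definition kite_cones : set (set 'M[R]_n) :=
  [set C | exists2 phi, kite phi & C = skew_cone phi].

End Tropical.

Arguments standard_cube R m : clear implicits.
Arguments skew_symmetric R n : clear implicits.
Arguments skew_cone R {n} phi.
Arguments kite_cones R n : clear implicits.

(* Main.v *)
Require Import Defs.
From HB Require Import structures.
From mathcomp Require Import all_boot all_order all_algebra.
From mathcomp Require Import all_classical all_reals all_analysis.
From mathcomp Require Import ring lra zify.

Set Implicit Arguments.
Unset Strict Implicit.
Unset Printing Implicit Defensive.

Import Order.TTheory GRing.Theory Num.Theory.
Import numFieldNormedType.Exports.

Local Open Scope classical_set_scope.
Local Open Scope ring_scope.

(** The slack of an ordered pair at (lam, x) is s_ij = lam + x_i - x_j - a_ij.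
    A connected function phi determines (lam, x), linearly in A, by requiring
    that the slacks of its edges vanish; Omega_phi is the cone on which the
    remaining slacks are nonnegative.  On skew-symmetric matrices
    s_ij + s_ji = 2 lam, so for a kite the slack of each of the n(n-3)/2
    unordered pairs that are not edges of phi ranges freely over [0, 2 lam],
    while x ranges freely over R^n modulo constants: this is R^(n-1) times the
    cone over a cube.  In the interior of the cone only the edges of phi have
    slack zero, so the eigenpair is unique and phi can be read off its linear
    map.

    Every matrix has an eigenpair whose zero slacks contain a connected
    function; for a skew-symmetric matrix with lam > 0 that function has no
    cycle of length at most 2, and if lam = 0 all slacks vanish, so any kite
    will do.  Hence the kite cones cover the skew-symmetric matrices, and every
    open cone of linearity lies in the interior of one of them.  For n >= 6 the
    cones of two kites whose cycles are disjoint triangles do not meet in a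
    common face. *)

(** * Polyhedral cones *)

Section Faces.
Context {R : realType} {V : lmodType R}.
Implicit Types (C D F : set V) (u v : V).

Lemma face_refl C : face C C.
Proof.
exists (\0 : {linear V -> R^o}); split=> //.
by apply/seteqP; split=> [v|v []].
Qed.

Lemma face_absorbs C F u v : face C F -> C u -> C v -> F (u + v) -> F u.
Proof.
case=> l [l_ge0 ->] Cu Cv [_ /eqP]; rewrite linearD.
by rewrite paddr_eq0 ?l_ge0 // => /andP[/eqP lu _].
Qed.

Lemma polyhedral_coneD C u v : polyhedral_cone C -> C u -> C v -> C (u + v).
Proof.
case=> k [l ->] lu lv i; rewrite linearD.
by apply: addr_ge0; [apply: lu|apply: lv].
Qed.

Lemma fan_absorbs (S : set (set V)) C D u v :
  fan S -> S C -> S D -> C u -> C v -> D (u + v) -> D u.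
Proof.
case=> _ poly _ inter SC SD Cu Cv Duv; have [CD _] := inter _ _ SC SD.
have CDuv : (C `&` D) (u + v).
  by split=> //; apply: polyhedral_coneD (poly _ SC) Cu Cv.
by case: (face_absorbs CD Cu Cv CDuv).
Qed.

Lemma gt0_along_line (I : finType) (P : {pred I}) (l : I -> {linear V -> R^o})
    (c v : V) :
  {in P, forall i, 0 < l i c} ->
  exists2 e : R, 0 < e &
    forall t, `|t| <= e -> {in P, forall i, 0 < l i (c + t *: v)}.
Proof.
move=> lc; pose bound i := l i c / (`|l i v| + 1).
have den_gt0 i : 0 < `|l i v| + 1 by rewrite ltr_wpDl.
have bound_gt0 i : i \in P -> 0 < bound i by move=> iP; rewrite divr_gt0 ?lc.
exists (\big[Num.min/1]_(i in P) bound i).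
  by elim/big_ind: _ => // x y x0 y0; rewrite lt_min x0.
move=> t te i iP; have {}te : `|t| <= bound i.
  by apply: le_trans te _; rewrite (bigD1 i) //= ge_min lexx.
have [->|t0] := eqVneq t 0; first by rewrite scale0r addr0 lc.
move: te; rewrite ler_pdivlMr // mulrDr mulr1 -normrM => te.
have : 0 < `|t| by rewrite normr_gt0.
have -> : l i (c + t *: v) = l i c + t * l i v by rewrite linearD linearZ.
by have := ler_norm (- (t * l i v)); rewrite normrN; lra.
Qed.

End Faces.

Section Spans.
Context {R : realType} {V : vectType R}.
Implicit Types (S : set V) (W : {vspace V}).

Lemma linear_span_uniq S W W' : linear_span S W -> linear_span S W' -> W = W'.
Proof.
move=> [SW Wmin] [SW' W'min]; apply/eqP.
by rewrite eqEsubv Wmin // W'min.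
Qed.

Lemma mem_capv_ker (l : {linear V -> R^o}) W v :
  (v \in (W :&: lker (linfun l))%VS) = (v \in W) && (l v == 0).
Proof. by rewrite memv_cap memv_ker lfunE. Qed.

Lemma dim_capv_ker (l : {linear V -> R^o}) W v : v \in W -> l v != 0 ->
  \dim W = (\dim (W :&: lker (linfun l))).+1.
Proof.
move=> vW lv; rewrite -(limg_ker_dim (linfun l) W).
have -> : (linfun l @: W)%VS = <[(linfun l v : R^o)]>%VS.
  apply/eqP; rewrite eqEsubv -memvE memv_img // andbT; apply/subvP => w _.
  by apply/vlineP; exists (w / l v); rewrite lfunE /= -[_ *: _]/(_ * _) divfK.
by rewrite dim_vline lfunE /= lv addn1.
Qed.

End Spans.

Section HalfspaceCones.
Context {R : realType} {V : vectType R} {I : finType}.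
Implicit Types (W : {vspace V}) (P : {pred I}) (l : I -> {linear V -> R^o}).
Implicit Types (c v : V) (F : set V).

Definition halfspace_cone W P l : set V :=
  [set v | v \in W /\ {in P, forall i, 0 <= l i v}].

Definition open_halfspace_cone W P l : set V :=
  [set v | v \in W /\ {in P, forall i, 0 < l i v}].

Definition tight_face W P l i : set V :=
  [set v | halfspace_cone W P l v /\ l i v = 0].

Lemma open_halfspace_coneW W P l :
  open_halfspace_cone W P l `<=` halfspace_cone W P l.
Proof. by move=> v [vW lv]; split=> // i /lv/ltW. Qed.

Lemma convex_halfspace_cone W P l : convex_cone (halfspace_cone W P l).
Proof.
split=> [a v a0 [vW lv]|v w [vW lv] [wW lw]]; split=> [|i iP].
- by rewrite memvZ.
- by rewrite linearZ mulr_ge0 ?lv // ltW.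
- by rewrite memvD.
- by rewrite linearD addr_ge0 ?lv ?lw.
Qed.

Lemma convex_open_halfspace_cone W P l :
  convex_cone (open_halfspace_cone W P l).
Proof.
split=> [a v a0 [vW lv]|v w [vW lv] [wW lw]]; split=> [|i iP].
- by rewrite memvZ.
- by rewrite linearZ mulr_gt0 ?lv.
- by rewrite memvD.
- by rewrite linearD addr_gt0 ?lv ?lw.
Qed.

Lemma open_halfspace_cone_line W P l c v :
  open_halfspace_cone W P l c -> v \in W ->
  exists2 e : R, 0 < e &
    forall t, `|t| <= e -> open_halfspace_cone W P l (c + t *: v).
Proof.
move=> [cW lc] vW; have [e e0 el] := gt0_along_line v lc.
by exists e => // t te; split; [rewrite memvD ?memvZ|apply: el].
Qed.

Lemma span_halfspace_cone W P l c : open_halfspace_cone W P l c ->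
  linear_span (halfspace_cone W P l) W.
Proof.
move=> c_open; split=> [v []//|W' sub]; apply/subvP => v vW.
have [e e0 eC] := open_halfspace_cone_line c_open vW.
have ce : c + e *: v \in W'.
  by apply/sub/open_halfspace_coneW/eC; rewrite gtr0_norm.
have -> : v = e^-1 *: (c + e *: v - c).
  by rewrite addrAC subrr add0r scalerA mulVf ?gt_eqF // scale1r.
by rewrite memvZ // memvB // sub //; apply: open_halfspace_coneW.
Qed.

Lemma affine_hull_halfspace_cone W P l c : open_halfspace_cone W P l c ->
  affine_hull (halfspace_cone W P l) = [set` W].
Proof.
move=> c_open; apply/seteqP; split=> [_ [k [a [p [pC _ ->]]]]|v /= vW].
  by apply: memv_suml => i _; rewrite memvZ //; case: (pC i).
have [e e0 eC] := open_halfspace_cone_line c_open vW.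
exists 3%N, (tnth [tuple e^-1; - e^-1; 1]).
exists (tnth [tuple c + e *: v; c; 0]); split.
- case=> -[|[|[|//]]] lt3; rewrite (tnth_nth 0) /=.
  + by apply/open_halfspace_coneW/eC; rewrite gtr0_norm.
  + exact: open_halfspace_coneW.
  + by split=> [|i _]; rewrite ?mem0v ?linear0.
- by rewrite !big_ord_recl big_ord0 !(tnth_nth 0) /=; ring.
- rewrite !big_ord_recl big_ord0 !(tnth_nth 0) /= scalerDr scalerA.
  rewrite mulVf ?gt_eqF // scale1r scaler0 !addr0 scaleNr.
  by rewrite addrAC subrr add0r.
Qed.

Lemma linear_ge0_eq0 W P l (f : {linear V -> R^o}) c :
  (forall v, halfspace_cone W P l v -> 0 <= f v) ->
  open_halfspace_cone W P l c -> f c = 0 -> {in W, forall v, f v = 0}.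
Proof.
move=> f_ge0 c_open fc v vW.
have [e e0 eC] := open_halfspace_cone_line c_open vW.
have sign t : `|t| <= e -> 0 <= t * f v.
  move=> te; have := f_ge0 _ (open_halfspace_coneW (eC t te)).
  by rewrite linearD fc add0r linearZ.
have := sign e; have := sign (- e); rewrite normrN gtr0_norm // lexx.
rewrite mulNr oppr_ge0 pmulr_rle0 // pmulr_rge0 // => /(_ isT) + /(_ isT).
by lra.
Qed.

Lemma tight_faceE W P l i : tight_face W P l i =
  halfspace_cone (W :&: lker (linfun (l i))) [predD1 P & i] l.
Proof.
apply/seteqP; split=> v.
  move=> [[vW lv] /eqP li]; split; first by rewrite mem_capv_ker vW.
  by move=> j /andP[_ /lv].
rewrite /halfspace_cone /= mem_capv_ker => -[/andP[vW /eqP li] lv].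
split=> //; split=> // j jP; have [->|ji] := eqVneq j i; first by rewrite li.
by apply: lv; rewrite inE ji.
Qed.

Lemma face_tight_face W P l i : i \in P ->
  face (halfspace_cone W P l) (tight_face W P l i).
Proof. by move=> iP; exists (l i); split=> // v [_]; apply. Qed.

(* If F lies in no tight face, summing witnesses gives a point of F at which
   every functional is positive. *)
Lemma face_open_or_tight W P l F : face (halfspace_cone W P l) F ->
  (exists2 i, i \in P & F `<=` tight_face W P l i) \/
  (exists2 v, F v & open_halfspace_cone W P l v).
Proof.
case=> f [f_ge0 FE].
have FC : F `<=` halfspace_cone W P l by rewrite FE => v [].
have [[i iP Fi]|no_tight] :=
  pselect (exists2 i, i \in P & F `<=` tight_face W P l i).
  by left; exists i.
have witness i : exists v, i \in P -> F v /\ 0 < l i v.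
  have [iP|] := boolP (i \in P); last by exists 0.
  have [v Fv /eqP liv] : exists2 v, F v & l i v <> 0.
    apply: contrapT => none; apply: no_tight; exists i => // v Fv.
    by split; [exact: FC|apply: contrapT => liv; apply: none; exists v].
  by exists v => _; split=> //; rewrite lt0r liv; case: (FC _ Fv) => _ ->.
have [a aP] := choice witness; pose v := \sum_(i in P) a i.
have aC i : i \in P -> halfspace_cone W P l (a i) by case/aP => /FC.
have v_open : open_halfspace_cone W P l v.
  split=> [|i iP]; first by apply: memv_suml => i /aC[].
  rewrite linear_sum (bigD1 i) //= ltr_pwDl //; first by case: (aP _ iP).
  by apply: sumr_ge0 => j /andP[/aC[_ ->]].
right; exists v => //; rewrite FE; split; first exact: open_halfspace_coneW.
by rewrite linear_sum big1 // => i /aP[]; rewrite FE => -[].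
Qed.

Section Facets.
Variables (W : {vspace V}) (P : {pred I}) (l : I -> {linear V -> R^o}) (c : V).
Hypothesis c_open : open_halfspace_cone W P l c.
Hypothesis irredundant : {in P, forall i, exists a, [/\ a \in W, l i a = 0 &
  {in P, forall j, j != i -> 0 < l j a}]}.

Lemma span_tight_face i : i \in P ->
  linear_span (tight_face W P l i) (W :&: lker (linfun (l i))).
Proof.
case/irredundant=> a [aW /eqP lia la]; rewrite tight_faceE.
apply: (@span_halfspace_cone _ _ _ a).
by split=> [|j /andP[/= ji jP]]; rewrite ?mem_capv_ker ?aW // la.
Qed.

Lemma dim_tight_face i : i \in P ->
  \dim W = (\dim (W :&: lker (linfun (l i)))).+1.
Proof.
move=> iP; have [cW lc] := c_open; apply: (dim_capv_ker cW).
by rewrite gt_eqF ?lc.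
Qed.

Lemma facet_halfspace_coneP F : facet (halfspace_cone W P l) F <->
  exists2 i, i \in P & F = tight_face W P l i.
Proof.
have span_cone := span_halfspace_cone c_open.
split=> [[faceF [WC [WF [sWC sWF]]]]|[i iP ->]]; last first.
  split; first exact: face_tight_face.
  exists W, (W :&: lker (linfun (l i)))%VS.
  by split=> //; [exact: span_tight_face|exact: dim_tight_face].
rewrite {sWC}(linear_span_uniq sWC span_cone) => dimWF.
have [f [f_ge0 FE]] := faceF.
case: (face_open_or_tight faceF) => [[i iP Fi]|[v + v_open]]; last first.
  rewrite {1}FE => -[_ fv]; have f0 := linear_ge0_eq0 f_ge0 v_open fv.
  have FC : F = halfspace_cone W P l.
    by rewrite FE; apply/seteqP; split=> [w []//|w Cw]; case: (Cw) => /f0.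
  move: sWF dimWF; rewrite FC => /linear_span_uniq/(_ span_cone) <- /eqP.
  by rewrite -addn1 -[X in X == _]addn0 eqn_add2l.
exists i => //; have [spani _] := span_tight_face iP.
have WFi : WF = (W :&: lker (linfun (l i)))%VS.
  apply/eqP; rewrite eqEdim -ltnS -dimWF -dim_tight_face // leqnn andbT.
  by case: sWF => _; apply=> w /Fi/spani.
have WF_ker : (WF <= lker (linfun f))%VS.
  case: sWF => _; apply=> w; rewrite FE => -[_ fw].
  by rewrite memv_ker lfunE /= fw.
apply/seteqP; split=> // w wi; rewrite FE; split; first by case: wi.
have := subvP WF_ker w; rewrite memv_ker lfunE WFi => /(_ (spani _ wi)).
by move/eqP.
Qed.

Lemma tight_face_inj : {in P &, injective (tight_face W P l)}.
Proof.
move=> i j iP jP E; apply/eqP/contraT => ij.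
have [a [aW lia la]] := irredundant iP.
suff : tight_face W P l j a by case=> _; move/eqP; rewrite gt_eqF ?la // eq_sym.
rewrite -E; split=> //; split=> // k kP.
by have [->|ki] := eqVneq k i; rewrite ?lia // ltW ?la.
Qed.

Lemma card_facets_halfspace_cone :
  ([set F | facet (halfspace_cone W P l) F] #= `I_#|P|)%card.
Proof.
have -> : [set F | facet (halfspace_cone W P l) F] =
    [set tight_face W P l i | i in [set` P]].
  apply/seteqP; split=> F => [/facet_halfspace_coneP[i iP ->]|[i iP <-]].
    by exists i.
  by apply/facet_halfspace_coneP; exists i.
apply: card_eq_trans (inj_card_eq _) _.
  by move=> i j; rewrite !inE; apply: tight_face_inj.
have -> : [set` P] = [set enum_val k | k in [set: 'I_#|P|]].
  apply/seteqP; split=> [i iP|_ [k _ <-]]; last exact: enum_valP.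
  by exists (enum_rank_in iP i) => //; rewrite enum_rankK_in.
apply: card_eq_trans (inj_card_eq _) _; first exact: in2W enum_val_inj.
by rewrite card_eq_sym card_II.
Qed.

End Facets.
End HalfspaceCones.

Section MatrixTopology.
Context {R : realType} {n : nat}.
Implicit Types (A B : 'M[R]_n) (l : {linear 'M[R]_n -> R^o}).

Lemma mx_linear_continuous l : continuous l.
Proof.
have -> : l = (fun A => \sum_i \sum_j A i j * l (delta_mx i j)) :> (_ -> _).
  apply/funext => A; rewrite {1}[A]matrix_sum_delta linear_sum.
  apply: eq_bigr => i _; rewrite linear_sum; apply: eq_bigr => j _.
  by rewrite linearZ.
apply: continuous_big => [|i _]; first exact: add_continuous.
apply: continuous_big => [|j _]; first exact: add_continuous.
move=> A; apply: (@cvgMr_tmp R _ (nbhs A) _ (fun B : 'M[R]_n => B i j)).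
exact: (@coord_continuous R n n i j A).
Qed.

Lemma open_halfspace l : open [set A | 0 < l A].
Proof.
apply: (@open_comp _ _ l [set t : R | 0 < t]); last exact: open_gt.
by move=> A _; apply: mx_linear_continuous.
Qed.

Lemma closed_halfspace l : closed [set A | 0 <= l A].
Proof.
apply: (@preimage_closed _ _ l [set t : R | 0 <= t]); last exact: closed_ge.
by move=> A _; apply: mx_linear_continuous.
Qed.

Lemma open_halfspaces (I : finType) (P : {pred I})
    (l : I -> {linear 'M[R]_n -> R^o}) :
  open [set A | {in P, forall i, 0 < l i A}].
Proof.
rewrite openE => A lA; apply: (@filter_forall _ _
  (fun i B => i \in P -> 0 < l i B) (nbhs A) _) => i.
have [iP|_] := boolP (i \in P); last exact: filterE.
have : nbhs A [set B | 0 < l i B].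
  by apply: open_nbhs_nbhs; split; [exact: open_halfspace|exact: lA].
by apply: filterS.
Qed.

Lemma nbhs_line A B (W : set 'M[R]_n) : nbhs A W ->
  exists2 e : R, 0 < e & forall t, `|t| <= e -> W (A + t *: B).
Proof.
move=> /nbhs_ballP[d /= d0 dW].
have B1 : 0 < `|B| + 1 by rewrite ltr_wpDl.
exists (d / (`|B| + 1)); first exact: divr_gt0.
move=> t; rewrite ler_pdivlMr // => td; apply: dW.
rewrite -ball_normE /= opprD addrA subrr sub0r normrN normrZ.
have [->|t0] := eqVneq t 0; first by rewrite normr0 mul0r.
by apply: lt_le_trans td; rewrite ltr_pM2l ?normr_gt0 // ltrDl.
Qed.

Lemma relint_halfspace_cone {I : finType} (W : {vspace 'M[R]_n}) (P : {pred I})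
    (l : I -> {linear 'M[R]_n -> R^o}) C :
  open_halfspace_cone W P l C ->
  relint (halfspace_cone W P l) = open_halfspace_cone W P l.
Proof.
move=> C_open; rewrite /relint (affine_hull_halfspace_cone C_open).
apply/seteqP; split=> [A [[AW _] nearA]|A A_open]; last first.
  split; first exact: open_halfspace_coneW.
  case: A_open => _ lA.
  have := open_nbhs_nbhs (conj (@open_halfspaces _ P l) lA).
  by apply: filterS => B lB BW; split=> // i /lB/ltW.
have [CW lC] := C_open; split=> // i iP.
have [e e0 eC] := nbhs_line C nearA.
have [|_ /(_ i iP)] := eC (- e) _ (memvD AW (memvZ _ CW)).
  by rewrite normrN gtr0_norm.
rewrite linearD linearZ /= scaleNr subr_ge0; apply: lt_le_trans.
by rewrite mulr_gt0 ?lC.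
Qed.

End MatrixTopology.

Section RieszRefinement.

Definition riesz_refinement {V : nmodType} (C : set V) : Prop :=
  forall u z v w, C u -> C z -> C v -> C w -> u + z = v + w ->
  exists a b c d, [/\ C a, C b, C c & C d] /\
    [/\ u = a + b, z = c + d, v = a + c & w = b + d].

Lemma riesz_refinement_image {U V : nmodType} (f : U -> V) (C : set U) :
  {morph f : u v / u + v} -> (forall u v, C u -> C v -> C (u + v)) ->
  {in C &, injective f} -> riesz_refinement C -> riesz_refinement (f @` C).
Proof.
move=> fD CD f_inj refine _ _ _ _ [u Cu <-] [z Cz <-] [v Cv <-] [w Cw <-].
rewrite -!fD => uz_vw; have {uz_vw} : u + z = v + w.
  by apply: f_inj uz_vw; rewrite inE; apply: CD.
case/(refine _ _ _ _ Cu Cz Cv Cw)=> a [b [c [d [[Ca Cb Cc Cd] [-> -> -> ->]]]]].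
by exists (f a), (f b), (f c), (f d); rewrite !fD.
Qed.

Context {R : realType}.

Lemma orthant_riesz_refinement (U : zmodType) k :
  riesz_refinement [set q : (U * 'rV[R]_k)%type | forall i, 0 <= q.2 0 i].
Proof.
move=> [xu cu] [xz cz] [xv cv] [xw cw] /= cu0 cz0 cv0 cw0 [Ex /rowP Ec].
pose m i := Num.min (cu 0 i) (cv 0 i).
have mP i :
    m i = cu 0 i /\ cu 0 i <= cv 0 i \/ m i = cv 0 i /\ cv 0 i <= cu 0 i.
  by rewrite /m; case: leP => [|/ltW]; [left|right].
have {}Ec i : cu 0 i + cz 0 i = cv 0 i + cw 0 i by have := Ec i; rewrite !mxE.
exists (xu, \row_i m i), (0, \row_i (cu 0 i - m i)).
exists (xv - xu, \row_i (cv 0 i - m i)).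
exists (xw, \row_i (cw 0 i - (cu 0 i - m i))); split; split=> /=.
- by move=> i; rewrite mxE; have := cu0 i; have := cv0 i; case: (mP i) => -[->].
- by move=> i; rewrite mxE; case: (mP i) => -[->]; lra.
- by move=> i; rewrite mxE; case: (mP i) => -[->]; lra.
- move=> i; rewrite mxE; move: (Ec i) (cz0 i) (cw0 i).
  by case: (mP i) => -[->]; lra.
- by congr (_, _); [rewrite addr0|apply/rowP => i; rewrite !mxE; ring].
- congr (_, _); first by rewrite addrAC -Ex addrC addKr.
  by apply/rowP => i; rewrite !mxE; have := Ec i; lra.
- congr (_, _); first by rewrite addrC subrK.
  by apply/rowP => i; rewrite !mxE; ring.
- by congr (_, _); [rewrite add0r|apply/rowP => i; rewrite !mxE; ring].
Qed.

Lemma simplicial_riesz_refinement {V : vectType R} (C : set V) :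
  simplicial_cone C -> riesz_refinement C.
Proof.
case=> L [k [s [s_free Ls ->]]].
pose comb (q : (subvs_of L * 'rV[R]_k)%type) : V :=
  vsval q.1 + \sum_(i < k) q.2 0 i *: tnth s i.
set C' := (X in riesz_refinement X).
have -> : C' = comb @`
      [set q : (subvs_of L * 'rV[R]_k)%type | forall i, 0 <= q.2 0 i].
  apply/seteqP; split=> [_ [u uL [c c0 ->]]|_ [[u c] c0 <-]]; last first.
    by exists (vsval u); [apply: subvsP|exists (c 0)].
  exists (vsproj L u, \row_i c i) => [i|]; first by rewrite mxE.
  by rewrite /comb /= vsprojK //; under eq_bigr do rewrite mxE.
apply: riesz_refinement_image (@orthant_riesz_refinement _ k) => [p q|p q|].
- rewrite /comb /= addrACA -big_split; congr (_ + _).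
  by apply: eq_bigr => i _; rewrite mxE scalerDl.
- by move=> p0 q0 i; rewrite mxE addr_ge0.
move=> [u c] [v d] _ _; rewrite /comb /= => E.
have Ed : vsval (u - v) = \sum_(i < k) (d 0 i - c 0 i) *: s`_i.
  under eq_bigr do rewrite scalerBl -(tnth_nth 0).
  rewrite sumrB raddfB /=; apply/eqP.
  by rewrite subr_eq addrAC eq_sym subr_eq addrC -E addrC.
have uv0 : vsval (u - v) = 0.
  apply/eqP; rewrite -memv0 -Ls memv_cap subvsP Ed.
  by apply: memv_suml => i _; rewrite memvZ // memv_span // mem_nth ?size_tuple.
have /freeP s_indep := s_free; congr (_, _).
  by apply/subr0_eq/val_inj; rewrite [LHS]uv0.
apply/rowP => i; apply/esym/subr0_eq.
by apply: (s_indep (fun i => d 0 i - c 0 i)); rewrite -Ed.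
Qed.

End RieszRefinement.

Section CubeCone.
Context {R : realType}.

Lemma cone_over_cubeP m (q : (R^o * 'rV[R]_m)%type) :
  cone_over (standard_cube R m) q <->
  0 <= q.1 /\ forall k, `|q.2 0 k| <= q.1.
Proof.
split=> [[t [p [t0 cube ->]]]|[t0 qt]] /=.
  by split=> // k; rewrite mxE normrM ger0_norm // ler_piMr // ler_norml cube.
case: q t0 qt => t u /= t0 ut; have [tz|tn] := eqVneq t 0.
  exists t, 0; split=> // [k|]; first by rewrite mxE; lra.
  rewrite scaler0; congr (_, _); apply/rowP => k; rewrite mxE.
  by apply/eqP; rewrite -normr_le0 -tz.
exists t, (t^-1 *: u); split=> // [k|]; last first.
  by rewrite scalerA mulfV // scale1r.
rewrite -ler_norml mxE normrM normfV (ger0_norm t0) ler_pdivrMl ?mulr1 //.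
by rewrite lt0r tn.
Qed.

(* The two diagonals of a square face have the same midpoint.  In a common
   refinement, each part of the first diagonal would lie on two opposite facets,
   hence have height 0. *)
Lemma cube_cone_not_riesz (U : nmodType) m : (2 <= m)%N ->
  ~ riesz_refinement ([set: U] `*` cone_over (standard_cube R m)).
Proof.
move=> m2; pose i : 'I_m := Ordinal (ltnW m2); pose j : 'I_m := Ordinal m2.
set K := (X in riesz_refinement X).
pose corner (s s' : bool) : (U * (R^o * 'rV[R]_m))%type :=
  (0, (1, (-1) ^+ s *: delta_mx 0 i + (-1) ^+ s' *: delta_mx 0 j)).
have corner_cone s s' : K (corner s s').
  split=> //; apply/cone_over_cubeP; split=> //= k; rewrite !mxE /=.
  have [->|ki] := eqVneq k i; first by rewrite mulr1 mulr0 addr0 normr_sign.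
  rewrite mulr0 add0r; case: eqP => _; last by rewrite mulr0 normr0.
  by rewrite mulr1 normr_sign.
have part s s' p q : K p -> K q -> corner s s' = p + q ->
    p.2.2 0 i = (-1) ^+ s * p.2.1 /\ p.2.2 0 j = (-1) ^+ s' * p.2.1.
  case: p q => [? [tp p]] [? [tq q]] [_ /cone_over_cubeP[/= _ p_le]].
  move=> [_ /cone_over_cubeP[/= _ q_le]] [_ height /rowP coord].
  have := coord i; have := coord j; rewrite !mxE /=.
  move: (p_le i) (q_le i) (p_le j) (q_le j) height; rewrite !ler_norml.
  by case: s {coord}; case: s' => /=; lra.
move=> /(_ _ _ _ _ (corner_cone false false) (corner_cone true true)
  (corner_cone false true) (corner_cone true false)) [].
  by congr (_, (_, _)); apply/rowP => k; rewrite !mxE /=; ring.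
move=> a [b [c [d [[Ka Kb Kc Kd] [uE _ vE wE]]]]].
have [_ a_upper] := part _ _ _ _ Ka Kb uE.
have [_ a_lower] := part _ _ _ _ Ka Kc vE.
have [b_lower _] := part _ _ _ _ Kb Kd wE.
have height : 1 = a.2.1 + b.2.1 :> R.
  by rewrite -[LHS]/(corner false false).2.1 uE.
rewrite addrC in uE; have [b_upper _] := part _ _ _ _ Kb Ka uE.
by move: a_upper a_lower b_upper b_lower height; rewrite /=; lra.
Qed.

End CubeCone.

(** * Functional graphs and kites *)

Definition no_short_cycle {T : eqType} (f : T -> T) : Prop :=
  forall i, f (f i) != i.

Section RootedFunctions.
Context {T : finType}.
Implicit Types (f : T -> T) (i r : T) (c : seq T).

Definition rooted f r : Prop := forall i, fconnect f i r.

Lemma fconnect_preserves f (P : pred T) i j :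
  (forall k, P k -> P (f k)) -> fconnect f i j -> P i -> P j.
Proof.
move=> Pf /iter_findex <- Pi; by elim: (findex f i j) => //= k; apply: Pf.
Qed.

Lemma rooted_mem_fcycle f r c :
  rooted f r -> c != [::] -> fcycle f c -> r \in c.
Proof.
case: c => // i c fr _ fc.
by rewrite -(fconnect_cycle fc (mem_head i c)) fr.
Qed.

Lemma rooted_fcycle_orbit f r : rooted f r -> fcycle f (orbit f r).
Proof. by move=> fr; rewrite -fconnect_f. Qed.

(* A selection along shortest paths strictly decreases the distance to r. *)
Lemma rooted_selection (G : rel T) r :
  (forall i, connect G i r) -> (exists j, G r j) ->
  exists f, (forall i, G i (f i)) /\ rooted f r.
Proof.
move=> Gr [j0 Grj].
pose reach i k := [exists p : k.-tuple T, path G i p && (last i p == r)].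
have ex_reach i : exists k, reach i k.
  have /connectP[p Gp lp] := Gr i; exists (size p).
  by apply/existsP; exists (in_tuple p); rewrite Gp /= -lp.
pose dist i := ex_minn (ex_reach i).
have closer i : exists j, G i j /\ (i != r -> (dist j < dist i)%N).
  have [->|ir] := eqVneq i r; first by exists j0.
  rewrite {2}/dist; case: ex_minnP => k /existsP[[p sp] /= +] _.
  move/eqP: sp => <-; case: p => [|j p] /=; first by rewrite (negPf ir).
  case/andP=> /andP[Gij Gp] lp; exists j; split=> // _.
  rewrite ltnS /dist; case: ex_minnP => m _; apply.
  by apply/existsP; exists (in_tuple p); rewrite Gp.
have [f fP] := choice closer; exists f; split=> i; first by case: (fP i).
have [k] := ubnP (dist i); elim: k i => // k IH i; rewrite ltnS => dist_k.
have [->//|ir] := eqVneq i r.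
apply: connect_trans (fconnect1 _ _) (IH _ _).
by apply: leq_trans dist_k; case: (fP i) => _ /(_ ir).
Qed.

End RootedFunctions.

Section Kites.
Context {n : nat}.
Implicit Types (phi : {ffun 'I_n -> 'I_n}) (r : 'I_n).

Lemma rooted_connected_function phi r : rooted phi r -> connected_function phi.
Proof.
move=> phi_root i j; pose e := [rel u v | (phi u == v) || (phi v == u)].
have e_sym : connect_sym e by apply: sym_connect_sym => u v /=; rewrite orbC.
have to_root u : connect e u r.
  apply: connect_sub (phi_root u) => v w /= /eqP <-.
  by apply: connect1; rewrite /= eqxx.
by apply: connect_trans (to_root i) _; rewrite e_sym.
Qed.

Lemma connected_function_rooted phi r :
  connected_function phi -> fconnect phi (phi r) r -> rooted phi r.
Proof.
move=> conn cyc i; have /connectP[p] := conn r i.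
elim/last_ind: p i => [|p j IH] i; first by move=> _ ->.
rewrite rcons_path last_rcons => /andP[/IH/(_ erefl) + + ->] /=.
set k := last r p => kr /orP[/eqP <-|/eqP jk]; last first.
  by rewrite -jk in kr; apply: connect_trans (fconnect1 _ _) kr.
by move: kr; rewrite fconnect_eqVf => /predU1P[->|].
Qed.

Lemma kiteP phi :
  kite phi <-> exists r, rooted phi r /\ no_short_cycle phi.
Proof.
split=> [[conn [c [/andP[fc uc] sc]]]|[r [phi_root phi_long]]].
  case: c fc uc sc => [|r [|a [|b c]]] // fc uc _; exists r.
  have phi_root : rooted phi r.
    apply: connected_function_rooted => //.
    by rewrite fconnect_f (orbitE fc uc (mem_head _ _)) rot_cycle.
  split=> // i; apply/eqP => phi_phi.
  have /andP[/eqP ra /andP[/eqP ab _]] := fc.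
  have /eqP : phi (phi r) == r.
    apply: (fconnect_preserves (P := fun j => phi (phi j) == j) _ (phi_root i)).
      by move=> j /eqP->.
    by rewrite phi_phi.
  by rewrite ra ab => br; move: uc; rewrite br /= !inE eqxx !orbT.
split; first exact: rooted_connected_function phi_root.
have fc := rooted_fcycle_orbit phi_root; exists (orbit phi r); split.
  by rewrite /ucycle /ucycleb fc orbit_uniq.
move: fc (in_orbit phi r); case: (orbit phi r) => [|i [|j [|//]]] //=.
  by rewrite andbT inE => /eqP ii /eqP ri; have := phi_long i; rewrite !ii eqxx.
by case/and3P=> /eqP ij /eqP ji _; have := phi_long i; rewrite ij ji eqxx.
Qed.

Definition ord_fun (f : nat -> nat) (f_lt : forall k, (f k < n)%N) :
  {ffun 'I_n -> 'I_n} := [ffun i => Ordinal (f_lt (val i))].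

Lemma val_iter_ord_fun f f_lt k i :
  val (iter k (@ord_fun f f_lt) i) = iter k f (val i).
Proof. by elim: k => //= k <-; rewrite ffunE. Qed.

Lemma kite_ord_fun f f_lt m : (m < n)%N ->
  (forall k, exists t, iter t f k = m) -> no_short_cycle f ->
  kite (@ord_fun f f_lt).
Proof.
move=> mn fr f_long; apply/kiteP; exists (Ordinal mn); split=> i.
  have [t tr] := fr (val i).
  have <- : iter t (ord_fun f_lt) i = Ordinal mn.
    by apply: val_inj; rewrite val_iter_ord_fun.
  exact: fconnect_iter.
by rewrite -val_eqE !ffunE /=.
Qed.

Lemma exists_kite : (3 <= n)%N -> exists phi, kite phi.
Proof.
move=> n3; pose f k := match k with 0 => 1 | 1 => 2 | _ => 0 end%N.
have f_lt k : (f k < n)%N.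
  by apply: leq_trans n3; case: k => [|[|k]].
exists (ord_fun f_lt); apply: (@kite_ord_fun _ _ 0).
- exact: ltnW (ltnW n3).
- by case=> [|[|k]]; [exists 0|exists 2|exists 1].
- by case=> [|[|k]].
Qed.

End Kites.

(** * Critical cycles and maximal paths *)

Section Edges.
Context {n : nat}.
Implicit Types (i j : 'I_n) (p q c : seq 'I_n) (f : 'I_n -> 'I_n).

Lemma path_edges_cat i p q :
  path_edges i (p ++ q) = path_edges i p ++ path_edges (last i p) q.
Proof. by elim: p i => //= j p IH i; rewrite /path_edges /= -IH. Qed.

Lemma path_edgesP (G : rel 'I_n) i p :
  {in path_edges i p, forall e, G e.1 e.2} <-> path G i p.
Proof.
elim: p i => //= j p IH i; rewrite /path_edges /= -/(path_edges j p); split.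
  move=> Ge; rewrite (Ge (i, j)) ?mem_head //=; apply/IH => e ep.
  by apply: Ge; rewrite inE ep orbT.
by case/andP=> Gij /IH Gp e; rewrite inE => /predU1P[->//|]; apply: Gp.
Qed.

Lemma path_edges_source i p e : e \in path_edges i p -> e.1 \in belast i p.
Proof.
elim: p i => //= j p IH i; rewrite /path_edges /= !inE.
by case/predU1P=> [->|/IH ->]; rewrite ?eqxx ?orbT.
Qed.

Lemma cycle_edges_cons i p :
  uniq (i :: p) -> cycle_edges (i :: p) = path_edges i (rcons p i).
Proof.
move=> uc; rewrite /path_edges belast_rcons /cycle_edges.
have -> : rcons p i = [seq next (i :: p) j | j <- i :: p].
  apply: (@eq_from_nth _ i) => [|k]; first by rewrite size_rcons size_map.
  rewrite size_rcons => kp; rewrite (nth_map i) // next_nth mem_nth //.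
  rewrite index_uniq // nth_rcons; case: ltngtP => // [|->]; last first.
    by rewrite nth_default.
  by move=> pk; move: kp; rewrite ltnS leqNgt pk.
by elim: {2 3 5}(i :: p) => //= j s <-.
Qed.

Lemma fcycle_edgesP f c : uniq c ->
  {in cycle_edges c, forall e, f e.1 = e.2} <-> fcycle f c.
Proof.
move=> uc; split=> [fe|fc _ /mapP[i ic ->] /=]; last by rewrite (nextE fc ic).
apply: cycle_from_next => // i ic; apply/eqP.
by apply: (fe (i, next c i)); apply: map_f.
Qed.

Lemma path_telescope (V : zmodType) (x : 'I_n -> V) i p :
  \sum_(e <- path_edges i p) (x e.1 - x e.2) = x i - x (last i p).
Proof.
elim: p i => [|j p IH] i; first by rewrite /path_edges big_nil subrr.
by rewrite /path_edges big_cons -/(path_edges j p) IH /= addrA subrK.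
Qed.

Lemma cycle_telescope (V : zmodType) (x : 'I_n -> V) c :
  uniq c -> \sum_(e <- cycle_edges c) (x e.1 - x e.2) = 0.
Proof.
case: c => [|i p] uc; first by rewrite big_nil.
by rewrite cycle_edges_cons // path_telescope last_rcons subrr.
Qed.

End Edges.

Section OrbitPaths.
Variables (n : nat) (f : 'I_n -> 'I_n).
Implicit Types (i k l r : 'I_n) (p : seq 'I_n).

Definition orbit_path i l : seq 'I_n := traject f (f i) (findex f i l).

Lemma belast_traject i m : belast i (traject f (f i) m) = traject f i m.
Proof. by elim: m i => //= m IH i; rewrite IH. Qed.

Lemma orbit_path_simple i l :
  fconnect f i l -> simple_path i l (orbit_path i l).
Proof.
move=> il; split; last by rewrite last_traject iter_findex.
rewrite -trajectS -(@take_traject _ f (fingraph.order f i)) ?findex_max //.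
by rewrite take_uniq // orbit_uniq.
Qed.

Lemma orbit_path_edges i l :
  {in path_edges i (orbit_path i l), forall e, f e.1 = e.2}.
Proof.
by move=> e /(proj2 (path_edgesP (frel f) i _) (fpath_traject _ _ _)) /eqP.
Qed.

Lemma orbit_path_uniq i l p :
  {in path_edges i p, forall e, f e.1 = e.2} -> simple_path i l p ->
  p = orbit_path i l.
Proof.
move=> fp [up lp].
have /fpathE pE : fpath f i p by apply/path_edgesP => e /fp/eqP.
rewrite /orbit_path -lp {2}pE last_traject findex_iter //.
move: up; rewrite {1}pE -trajectS => up.
rewrite -size_orbit -(size_traject f i (size p).+1).
apply: uniq_leq_size up _ => j /trajectP[k _ ->].
by rewrite -fconnect_orbit fconnect_iter.
Qed.

Lemma simple_cycle_orbit r : simple_cycle (orbit f r).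
Proof.
by split=> [E|]; [have := in_orbit f r; rewrite E|apply: orbit_uniq].
Qed.

Lemma orbit_entry r i : rooted f r ->
  exists l, [/\ l \in orbit f r, fconnect f i l &
    {in belast i (orbit_path i l), forall k, k \notin orbit f r}].
Proof.
move=> fr; have ex_entry : exists t, iter t f i \in orbit f r.
  by exists (findex f i r); rewrite iter_findex // in_orbit.
have [t t_orbit t_min] := ex_minnP ex_entry; set l := iter t f i in t_orbit.
have il : fconnect f i l by apply: fconnect_iter.
have findex_le : (findex f i l <= t)%N.
  rewrite leqNgt; apply/negP => lt; have := findex_max il.
  by move=> /(ltn_trans lt)/findex_iter; rewrite -/l => E; rewrite E ltnn in lt.
exists l; split=> // k; rewrite /orbit_path belast_traject.
case/trajectP=> m mt ->.
by apply/negP => /t_min; rewrite leqNgt (leq_trans mt findex_le).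
Qed.

End OrbitPaths.

Lemma exists_max_uniq_seq (R : realDomainType) (T : finType) (P : pred (seq T))
    (F : seq T -> R) p0 :
  (forall p, P p -> uniq p) -> P p0 ->
  exists2 p, P p & forall q, P q -> F q <= F p.
Proof.
move=> Pu Pp0; have size_le p : P p -> (size p <= #|T|)%N.
  by move/Pu/card_uniqP <-; apply: max_card.
have := @arg_maxP _ R _ (Bseq (size_le _ Pp0)) (fun p => P (val p))
          (fun p => F (val p)) Pp0.
case=> p Pp pmax; exists (val p) => // q Pq.
exact: (pmax (Bseq (size_le _ Pq))).
Qed.

Section Slack.
Context {R : realType} {n : nat}.
Implicit Types (A : 'M[R]_n) (lam : R) (x : 'I_n -> R) (i j : 'I_n).
Implicit Types (p c : seq 'I_n) (f : 'I_n -> 'I_n).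

Definition slack A lam x i j : R := lam + x i - x j - A i j.

Definition subeigenpair A lam x : Prop := forall i j, 0 <= slack A lam x i j.

Definition saturated A lam x f : Prop := forall i, slack A lam x i (f i) = 0.

Definition zero_slack A lam x (s : seq ('I_n * 'I_n)) : Prop :=
  {in s, forall e, slack A lam x e.1 e.2 = 0}.

Lemma saturated0P A lam f :
  saturated A lam (fun=> 0) f <-> forall i, A i (f i) = lam.
Proof. by split=> Ai i; have := Ai i; rewrite /slack; lra. Qed.

Lemma zero_slack_saturated A lam x f s : saturated A lam x f ->
  {in s, forall e, f e.1 = e.2} -> zero_slack A lam x s.
Proof. by move=> sat fs e /fs <-. Qed.

Lemma sum_slack_ge0 A lam x s : subeigenpair A lam x ->
  0 <= \sum_(e <- s) slack A lam x e.1 e.2.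
Proof. by move=> sub; apply: sumr_ge0. Qed.

Lemma sum_slack_eq0 A lam x s : subeigenpair A lam x ->
  \sum_(e <- s) slack A lam x e.1 e.2 = 0 <-> zero_slack A lam x s.
Proof.
move=> sub; split=> [/eqP|s0]; last by rewrite big_seq big1 // => e /s0.
by rewrite psumr_eq0 // => /allP s0 e /s0/eqP.
Qed.

Lemma sum_path_slack A lam x i p :
  \sum_(e <- path_edges i p) (A e.1 e.2 - lam) =
  x i - x (last i p) - \sum_(e <- path_edges i p) slack A lam x e.1 e.2.
Proof.
rewrite -path_telescope -sumrB; apply: eq_bigr => e _; rewrite /slack; ring.
Qed.

Lemma sum_cycle_slack A lam x c : simple_cycle c ->
  \sum_(e <- cycle_edges c) slack A lam x e.1 e.2 =
  (size c)%:R * (lam - cycle_mean A c).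
Proof.
case=> c0 uc; have sc : (size c)%:R != 0 :> R.
  by rewrite pnatr_eq0; case: c c0 {uc}.
rewrite mulrBr mulrCA mulfV // mulr1.
have <- : \sum_(e <- cycle_edges c) lam = (size c)%:R * lam.
  by rewrite big_const_seq count_predT size_map iter_addr_0 mulr_natl.
rewrite -sumrB -[RHS]addr0 -[X in _ = _ + X](cycle_telescope x uc) -big_split.
by apply: eq_bigr => e _; rewrite /slack /=; ring.
Qed.

Lemma cycle_mean_le A lam x c :
  subeigenpair A lam x -> simple_cycle c -> cycle_mean A c <= lam.
Proof.
move=> sub sc; have := sum_slack_ge0 (cycle_edges c) sub.
rewrite (sum_cycle_slack _ _ x sc) pmulr_rge0 ?subr_ge0 //.
by rewrite ltr0n; case: sc; case: c.
Qed.

Lemma cycle_mean_eq A lam x c : subeigenpair A lam x -> simple_cycle c ->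
  cycle_mean A c = lam <-> zero_slack A lam x (cycle_edges c).
Proof.
move=> sub sc; rewrite -sum_slack_eq0 // (sum_cycle_slack _ _ x sc).
split=> [->|/eqP]; first by rewrite subrr mulr0.
rewrite mulf_eq0 pnatr_eq0 subr_eq0 => /orP[|/eqP//].
by case: sc; case: (c).
Qed.

End Slack.

Section MaximalPaths.
Context {R : realType} {n : nat}.
Implicit Types (A : 'M[R]_n) (i j l r : 'I_n) (p q c : seq 'I_n).

Lemma exists_critical_cycle A (i0 : 'I_n) : exists c, critical_cycle A c.
Proof.
have [c /andP[c0 uc] cmax] := @exists_max_uniq_seq R _
  (fun c : seq 'I_n => (c != [::]) && uniq c) (cycle_mean A) [:: i0]
  (fun c => @proj2 _ _ \o elimT andP) isT.
exists c; split=> [|c' [c'0 uc']]; first by split=> //; apply/eqP.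
by apply: cmax; rewrite uc' andbT; apply/eqP.
Qed.

Lemma trop_eigenvalue_critical A c :
  critical_cycle A c -> trop_eigenvalue A = cycle_mean A c.
Proof.
move=> [sc cmax].
have ub : ubound [set cycle_mean A c' | c' in simple_cycle] (cycle_mean A c).
  by move=> _ [c' sc' <-]; apply: cmax.
apply/eqP; rewrite eq_le; apply/andP; split.
  by apply: ge_sup => //; exists (cycle_mean A c); exists c.
by apply: ub_le_sup; [exists (cycle_mean A c)|exists c].
Qed.

Lemma cycle_mean_le_trop_eigenvalue A c :
  simple_cycle c -> cycle_mean A c <= trop_eigenvalue A.
Proof.
case: c => [[]//|i p] sc; have [d cd] := exists_critical_cycle A i.
by rewrite (trop_eigenvalue_critical cd); case: cd => _; apply.
Qed.

Lemma simple_path_refl i p : simple_path i i p -> p = [::].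
Proof.
case: p => // j p [/andP[/negP i_notin _] /= last_i]; case: i_notin.
by rewrite -{1}last_i mem_last.
Qed.

Lemma exists_maximal_path A i l : exists p, maximal_path A i l p.
Proof.
have [||p /andP[up /eqP lp] pmax] := @exists_max_uniq_seq R _
  (fun p => uniq (i :: p) && (last i p == l)) (path_weight A i)
  (if i == l then [::] else [:: l]).
- by move=> p /andP[/andP[]].
- by case: eqVneq => /= [->|il]; rewrite ?eqxx ?inE ?il.
by exists p; split=> // q [uq lq]; apply: pmax; rewrite uq lq eqxx.
Qed.

Lemma path_weight_nil A i : path_weight A i [::] = 0.
Proof. by rewrite /path_weight big_nil. Qed.

Lemma path_weight_cons A i j p :
  path_weight A i (j :: p) = A i j - trop_eigenvalue A + path_weight A j p.
Proof. by rewrite /path_weight /path_edges big_cons. Qed.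

Lemma path_weight_cat A i p q :
  path_weight A i (p ++ q) = path_weight A i p + path_weight A (last i p) q.
Proof. by rewrite /path_weight path_edges_cat big_cat. Qed.

Lemma closed_path_weight_le0 A i p :
  uniq (i :: p) -> path_weight A i (rcons p i) <= 0.
Proof.
move=> uip; have sc : simple_cycle (i :: p) by [].
have -> : path_weight A i (rcons p i) =
    - ((size p).+1%:R * (trop_eigenvalue A - cycle_mean A (i :: p))).
  rewrite -(sum_cycle_slack _ _ (fun=> 0) sc) -sumrN /path_weight.
  rewrite -cycle_edges_cons //; apply: eq_bigr => e _; rewrite /slack; ring.
by rewrite oppr_le0 mulr_ge0 // subr_ge0 cycle_mean_le_trop_eigenvalue.
Qed.

(* If the edge i -> j closes a cycle with the path from j, that cycle can be
   removed without decreasing the weight. *)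
Lemma maximal_path_triangle A i j r p q :
  maximal_path A i r p -> maximal_path A j r q ->
  A i j - trop_eigenvalue A + path_weight A j q <= path_weight A i p.
Proof.
move=> [_ pmax] [[uq lq] _]; rewrite -path_weight_cons.
have [iq|iq] := boolP (i \in j :: q); last first.
  by apply: pmax; split; rewrite // cons_uniq iq.
have {lq} : last i (j :: q) = r by [].
case/splitPr: iq uq => q1 q2; rewrite last_cat cat_uniq /=.
move=> /and3P[uq1 + /andP[iq2 uq2]] lq2; rewrite negb_or => /andP[iq1 _].
rewrite -cat_rcons path_weight_cat last_rcons -[leRHS]add0r lerD //.
  by apply: closed_path_weight_le0; rewrite /= iq1.
by apply: pmax; split=> //=; rewrite iq2.
Qed.

Lemma exists_rooted_saturated A (i0 : 'I_n) : exists lam x f r,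
  [/\ subeigenpair A lam x, saturated A lam x f & rooted f r].
Proof.
have [c cc] := exists_critical_cycle A i0; have [sc _] := cc.
case: c cc sc => [|r c] cc sc; first by case: sc.
pose lam := trop_eigenvalue A.
have [b bP] := choice (fun i => exists_maximal_path A i r).
pose x i := path_weight A i (b i).
have sub : subeigenpair A lam x.
  move=> i j; have := maximal_path_triangle (bP i) (bP j).
  by rewrite -/lam /slack -!/(x _); lra.
have xr : x r = 0.
  by have [/simple_path_refl br _] := bP r; rewrite /x br path_weight_nil.
pose G := [rel i j | slack A lam x i j == 0].
have Gb i : path G i (b i).
  apply/path_edgesP => e eb; apply/eqP; move: e eb; apply/sum_slack_eq0 => //.
  have [[_ lb] _] := bP i; have := sum_path_slack A lam x i (b i).
  by rewrite -[LHS]/(x i) lb xr; lra.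
have [||f [Gf fr]] := @rooted_selection _ G r.
- by move=> i; apply/connectP; exists (b i) => //; case: (bP i) => -[].
- exists (next (r :: c) r); apply/eqP.
  have zc : zero_slack A lam x (cycle_edges (r :: c)).
    by apply/cycle_mean_eq; rewrite // -(trop_eigenvalue_critical cc).
  by apply: (zc (r, _)); apply/mapP; exists r; rewrite ?mem_head.
by exists lam, x, f, r; split=> // i; apply/eqP/Gf.
Qed.

End MaximalPaths.

Section RootedSaturated.
Context {R : realType} {n : nat}.
Variables (A : 'M[R]_n) (lam : R) (x : 'I_n -> R) (f : 'I_n -> 'I_n) (r : 'I_n).
Hypothesis sub : subeigenpair A lam x.
Hypothesis sat : saturated A lam x f.
Hypothesis fr : rooted f r.

Lemma cycle_mean_orbit : cycle_mean A (orbit f r) = lam.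
Proof.
apply/(cycle_mean_eq sub (simple_cycle_orbit f r)).
apply: zero_slack_saturated sat _; apply/fcycle_edgesP; first exact: orbit_uniq.
exact: rooted_fcycle_orbit.
Qed.

Lemma critical_cycle_orbit : critical_cycle A (orbit f r).
Proof.
split=> [|c sc]; first exact: simple_cycle_orbit.
by rewrite cycle_mean_orbit (cycle_mean_le sub).
Qed.

Lemma trop_eigenvalue_saturated : trop_eigenvalue A = lam.
Proof.
by rewrite (trop_eigenvalue_critical critical_cycle_orbit) cycle_mean_orbit.
Qed.

Lemma critical_cycleP c :
  critical_cycle A c <-> simple_cycle c /\ zero_slack A lam x (cycle_edges c).
Proof.
split=> [cc|[sc /(cycle_mean_eq sub sc) cm]].
  have [sc _] := cc; split=> //; apply/(cycle_mean_eq sub sc).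
  by rewrite -(trop_eigenvalue_critical cc) trop_eigenvalue_saturated.
by split=> // c' sc'; rewrite cm (cycle_mean_le sub).
Qed.

Lemma path_weight_slack i p : path_weight A i p =
  x i - x (last i p) - \sum_(e <- path_edges i p) slack A lam x e.1 e.2.
Proof.
by rewrite /path_weight trop_eigenvalue_saturated (sum_path_slack _ _ x).
Qed.

Lemma zero_slack_orbit_path i l :
  zero_slack A lam x (path_edges i (orbit_path f i l)).
Proof. exact: zero_slack_saturated sat (@orbit_path_edges _ _ _ _). Qed.

Lemma maximal_pathP i l p : fconnect f i l ->
  maximal_path A i l p <->
  simple_path i l p /\ zero_slack A lam x (path_edges i p).
Proof.
move=> il; split=> [[sp pmax]|[sp /(sum_slack_eq0 _ sub) p0]]; split=> //.
  apply/(sum_slack_eq0 _ sub)/eqP; rewrite eq_le sum_slack_ge0 // andbT.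
  have sq := orbit_path_simple il; have [[_ lp] [_ lq]] := (sp, sq).
  have /(sum_slack_eq0 _ sub) q0 := @zero_slack_orbit_path i l.
  by have := pmax _ sq; rewrite !path_weight_slack lp lq q0; lra.
move=> q [uq lq]; have [_ lp] := sp; rewrite !path_weight_slack lp lq p0 subr0.
by rewrite gerBl sum_slack_ge0.
Qed.

Lemma critical_edge_slack i j :
  generic A -> critical_edge A i j -> slack A lam x i j = 0.
Proof.
case=> c0 [_ cuniq _] [c cc]; have [sc c0P] := (critical_cycleP c).1 cc.
case=> [/c0P //|[v [l [p [vc lc pmax pc ip]]]]].
suff vl : fconnect f v l by have [_ /(_ _ ip)] := (maximal_pathP p vl).1 pmax.
apply: connect_trans (fr v) _; rewrite fconnect_orbit.
have [k ->] := cuniq _ critical_cycle_orbit.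
by have [k' cE] := cuniq _ cc; rewrite mem_rot; rewrite cE mem_rot in lc.
Qed.

Section Strict.
Hypothesis strict : forall i j, slack A lam x i j = 0 -> f i = j.

Lemma strict_critical_cycleP c :
  critical_cycle A c <-> simple_cycle c /\ fcycle f c.
Proof.
rewrite critical_cycleP; split=> -[sc tight]; split=> //; have [_ uc] := sc.
  by apply/(fcycle_edgesP f uc) => e /tight/strict.
by apply: zero_slack_saturated sat _; apply/(fcycle_edgesP f uc).
Qed.

Lemma strict_maximal_pathP i l p : fconnect f i l ->
  maximal_path A i l p <-> p = orbit_path f i l.
Proof.
move=> il; rewrite maximal_pathP //; split=> [[sp p0]|->].
  by apply: orbit_path_uniq sp => e /p0/strict.
by split; [exact: orbit_path_simple|exact: zero_slack_orbit_path].
Qed.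

Lemma strict_generic : generic A.
Proof.
exists (orbit f r); split; first exact: critical_cycle_orbit.
- move=> c /strict_critical_cycleP[[/eqP c0 uc] fc].
  have rc := rooted_mem_fcycle fr c0 fc.
  exists (size c - index r c)%N; rewrite (orbitE fc uc rc).
  by have := rotK (index r c) c; rewrite /rotr size_rot.
- move=> i l; rewrite -fconnect_orbit => rl.
  have il := connect_trans (fr i) rl.
  exists (orbit_path f i l); split; first exact/(strict_maximal_pathP _ il).
  by move=> p /(strict_maximal_pathP _ il).
Qed.

Lemma strict_critical_edge i j : critical_edge A i j <-> f i = j.
Proof.
split=> [[c /strict_critical_cycleP[[/eqP c0 uc] fc]]|<-].
  case=> [/(proj2 (fcycle_edgesP f uc) fc)//|[v [l [p [vc lc pmax _ ip]]]]].
  have vl : fconnect f v l.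
    apply: connect_trans (fr v) _.
    by rewrite (fconnect_cycle fc (rooted_mem_fcycle fr c0 fc)).
  move: ip; rewrite (proj1 (strict_maximal_pathP _ vl) pmax).
  by move/orbit_path_edges.
have fo := rooted_fcycle_orbit fr.
exists (orbit f r); first exact: critical_cycle_orbit.
have [ic|ic] := boolP (i \in orbit f r).
  by left; apply/mapP; exists i; rewrite ?(nextE fo ic).
right; have [l [lr il outside]] := orbit_entry i fr.
exists i, l, (orbit_path f i l); split=> //.
- exact/(strict_maximal_pathP _ il).
- move=> e /path_edges_source/outside; apply: contra.
  by case/mapP=> k kr ->.
- have : i != l by apply: contraNneq ic => ->.
  rewrite -(findex_eq0 f) /orbit_path /path_edges.
  by case: findex => //= m _; rewrite mem_head.
Qed.

End Strict.
End RootedSaturated.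

(** * Eigenpairs *)

Section Eigenpairs.
Context {R : realType} {n : nat}.
Implicit Types (A : 'M[R]_n) (x y : 'cV[R]_n) (i j : 'I_n).

Lemma eigenpairP A lam x : eigenpair A lam x <->
  subeigenpair A lam (x^~ 0) /\
  forall i, exists j, slack A lam (x^~ 0) i j = 0.
Proof.
split=> [Ax|[sub ex0] i].
  have sub : subeigenpair A lam (x^~ 0).
    move=> i j; have : A i j + x j 0 <= lam + x i 0 by rewrite -Ax le_bigmax.
    by rewrite /slack; lra.
  split=> // i; have : lam + x i 0 <= lam + x i 0 by [].
  rewrite -[X in _ <= X]Ax => /bigmax_geP[le_i|[j _ le_j]]; [exists i|exists j].
    by move: le_i (sub i i); rewrite /slack; lra.
  by move: le_j (sub i j); rewrite /slack; lra.
have [j j0] := ex0 i; apply/eqP; rewrite eq_le; apply/andP; split.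
  apply/bigmax_leP; split=> [|k _].
    by have := sub i i; rewrite /slack; lra.
  by have := sub i k; rewrite /slack; lra.
have -> : lam + x i 0 = A i j + x j 0 by move: j0; rewrite /slack; lra.
exact: le_bigmax.
Qed.

Lemma saturated_eigenpair A lam x f : subeigenpair A lam (x^~ 0) ->
  saturated A lam (x^~ 0) f -> eigenpair A lam x.
Proof. by move=> sub sat; apply/eigenpairP; split=> // i; exists (f i). Qed.

Lemma tp_eq_sym x y : tp_eq x y -> tp_eq y x.
Proof.
by case=> c ->; exists (- c); apply/colP => i; rewrite !mxE; ring.
Qed.

Lemma tp_eq_trans x y z : tp_eq x y -> tp_eq y z -> tp_eq x z.
Proof.
by case=> c -> [d ->]; exists (d + c); apply/colP => i; rewrite !mxE; ring.
Qed.

Lemma tp_eq_slack A lam x y : tp_eq x y ->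
  slack A lam (x^~ 0) =2 slack A lam (y^~ 0).
Proof. by case=> c -> i j; rewrite /slack !mxE; ring. Qed.

(* Compare at the index where y - x is maximal. *)
Lemma eigenvalue_le A lam mu x y (i0 : 'I_n) :
  eigenpair A lam x -> eigenpair A mu y -> mu <= lam.
Proof.
move=> /eigenpairP[sub _] /eigenpairP[_ ex0].
have [i _ imax] := @arg_maxP _ R _ i0 predT (fun i => y i 0 - x i 0) isT.
have [j] := ex0 i; move: (sub i j) (imax j isT); rewrite /slack /=; lra.
Qed.

(* The difference z = y - x of two eigenvectors decreases along f.  At a maximum
   of z, an edge of zero slack for y also has zero slack for x, hence is the
   edge of f; so the maximum propagates along f to the root. *)
Lemma strict_unique_eigenpair A lam x f r : rooted f r ->
  subeigenpair A lam (x^~ 0) -> saturated A lam (x^~ 0) f ->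
  (forall i j, slack A lam (x^~ 0) i j = 0 -> f i = j) ->
  unique_eigenpair A lam x.
Proof.
move=> fr sub sat strict; have Ax := saturated_eigenpair sub sat.
split=> // mu y Ay; have mu_lam : mu = lam.
  apply/eqP; rewrite eq_le.
  by rewrite (eigenvalue_le r Ax Ay) (eigenvalue_le r Ay Ax).
rewrite mu_lam in Ay; have /eigenpairP[suby ex0y] := Ay; split=> //.
pose z i := y i 0 - x i 0.
have z_dec i : z (f i) <= z i.
  by have := suby i (f i); have := sat i; rewrite /slack /z; lra.
have z_next i : exists2 j, z i <= z j & slack A lam (x^~ 0) i j = z j - z i.
  have [j j0] := ex0y i; exists j; move: j0 (sub i j); rewrite /slack /z; lra.
have [a _ amax] := @arg_maxP _ R _ r predT z isT.
have {}amax i : z i <= z a by apply: amax.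
have zr : z r = z a.
  apply/eqP.
  apply: (fconnect_preserves (P := fun i => z i == z a) _ (fr a)) => // i.
  move=> /eqP zi; have [j zij] := z_next i.
  have -> : z j = z i by apply/eqP; rewrite eq_le zij zi amax.
  by rewrite subrr => /strict ->; rewrite eq_le amax /= -zi.
exists (z r); apply/colP => i; rewrite !mxE.
suff -> : z r = z i by rewrite /z; ring.
apply/eqP; rewrite eq_le; apply/andP; split; last by rewrite zr.
by rewrite -(iter_findex (fr i)); elim: findex => //= k /(le_trans (z_dec _)).
Qed.

Lemma unique_eigenpair_eq A lam mu x y :
  unique_eigenpair A lam x -> unique_eigenpair A mu y ->
  lam = mu /\ tp_eq x y.
Proof. by move=> [Ax _] [_]; apply. Qed.

End Eigenpairs.

(** * The eigenpair map of a connected function *)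

Section Eigenmap.
Context {R : realType} {n : nat}.
Variables (phi : {ffun 'I_n -> 'I_n}) (r : 'I_n).
Implicit Types (A B : 'M[R]_n) (i j : 'I_n) (p : 'I_n * 'I_n) (x : 'I_n -> R).

Definition walk_sum A i k : R :=
  \sum_(t < k) A (iter t phi i) (iter t.+1 phi i).

(* The mean weight of the cycle of phi through r. *)
Definition eigval A : R^o :=
  walk_sum A r (findex phi (phi r) r).+1 / (findex phi (phi r) r).+1%:R.

Definition potential i A : R^o :=
  walk_sum A i (findex phi i r) - (findex phi i r)%:R * eigval A.

Definition eigenmap A : R * 'cV[R]_n := (eigval A, \col_i potential i A).

Definition reduced p A : R^o := slack A (eigval A) (potential^~ A) p.1 p.2.

Definition off_graph : pred ('I_n * 'I_n) := [pred p | phi p.1 != p.2].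

Lemma walk_sum_linear (a : R) A B i k :
  walk_sum (a *: A + B) i k = a * walk_sum A i k + walk_sum B i k.
Proof.
by rewrite mulr_sumr -big_split; apply: eq_bigr => t _; rewrite !mxE.
Qed.

Lemma walk_sumS A i k :
  walk_sum A i k.+1 = A i (phi i) + walk_sum A (phi i) k.
Proof.
rewrite /walk_sum big_ord_recl; congr (_ + _); apply: eq_bigr => t _.
by rewrite -!iterSr.
Qed.

Lemma eigval_linear : linear eigval.
Proof. by move=> a A B; rewrite /eigval walk_sum_linear mulrDl -mulrA. Qed.

HB.instance Definition _ :=
  GRing.isLinear.Build R 'M[R]_n R^o *:%R eigval eigval_linear.

Lemma potential_linear i : linear (potential i).
Proof.
move=> a A B; rewrite -[RHS]/(a * potential i A + potential i B) /potential.
by rewrite walk_sum_linear (eigval_linear a A B : _ = a * _ + _); ring.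
Qed.

HB.instance Definition _ i :=
  GRing.isLinear.Build R 'M[R]_n R^o *:%R (potential i) (potential_linear i).

Lemma reduced_linear p : linear (reduced p).
Proof.
move=> a A B; rewrite -[RHS]/(a * reduced p A + reduced p B) /reduced /slack.
rewrite !mxE (eigval_linear a A B : _ = a * _ + _).
by rewrite !(potential_linear _ a A B : _ = a * _ + _); ring.
Qed.

HB.instance Definition _ p :=
  GRing.isLinear.Build R 'M[R]_n R^o *:%R (reduced p) (reduced_linear p).

Lemma eigenmap_skew_linear : skew_linear eigenmap.
Proof.
move=> a A B _ _; split; first exact: eigval_linear.
by exists 0; apply/colP => i; rewrite !mxE potential_linear addr0.
Qed.

Lemma slack_eigenmap A i j :
  slack A (eigenmap A).1 ((eigenmap A).2^~ 0) i j = reduced (i, j) A.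
Proof. by rewrite /reduced /slack !mxE. Qed.

Lemma potential_root A : potential r A = 0.
Proof. by rewrite /potential findex0 /walk_sum big_ord0 mul0r subr0. Qed.

Hypothesis phi_root : rooted phi r.

Lemma reduced_graph A i : reduced (i, phi i) A = 0.
Proof.
rewrite /reduced /slack /=; have [->|ir] := eqVneq i r.
  rewrite potential_root /potential /eigval walk_sumS.
  set k := findex phi (phi r) r; have : k.+1%:R != 0 :> R by rewrite pnatr_eq0.
  by rewrite -natr1 => k0; field.
rewrite /potential (fconnect_findex (phi_root i)) 1?eq_sym // walk_sumS -natr1.
ring.
Qed.

Section Evaluation.
Variables (A : 'M[R]_n) (lam : R) (x : 'I_n -> R).
Hypothesis sat : saturated A lam x phi.

Lemma walk_sumE i k : walk_sum A i k = k%:R * lam + x i - x (iter k phi i).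
Proof.
elim: k i => [|k IH] i.
  by rewrite /walk_sum big_ord0 mul0r /= add0r subrr.
rewrite walk_sumS IH -iterSr -natr1; have := sat i; rewrite /slack => E.
have -> : A i (phi i) = lam + x i - x (phi i) by move: E; lra.
ring.
Qed.

Lemma eigvalE : eigval A = lam.
Proof.
rewrite /eigval walk_sumE iterSr iter_findex // addrK.
by rewrite mulrAC mulfV ?mul1r // pnatr_eq0.
Qed.

Lemma potentialE i : potential i A = x i - x r.
Proof. by rewrite /potential eigvalE walk_sumE iter_findex //; ring. Qed.

Lemma reducedE p : reduced p A = slack A lam x p.1 p.2.
Proof. by rewrite /reduced /slack eigvalE !potentialE; ring. Qed.

End Evaluation.

Lemma saturated_potential A : saturated A (eigval A) (potential^~ A) phi.
Proof. by move=> i; apply: (reduced_graph A i). Qed.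

Lemma subeigenpair_potential A : {in off_graph, forall p, 0 <= reduced p A} ->
  subeigenpair A (eigval A) (potential^~ A).
Proof.
move=> A_ge0 i j; rewrite -/(reduced (i, j) A).
by have [<-|ij] := eqVneq (phi i) j; rewrite ?reduced_graph ?(A_ge0 (i, j)).
Qed.

Section Strict.
Variable A : 'M[R]_n.
Hypothesis A_gt0 : {in off_graph, forall p, 0 < reduced p A}.

Lemma reduced_eq0 i j : reduced (i, j) A = 0 -> phi i = j.
Proof.
have [//|ij] := eqVneq (phi i) j.
by move/eqP; rewrite gt_eqF // (@A_gt0 (i, j)).
Qed.

Lemma strict_subeigenpair : subeigenpair A (eigval A) (potential^~ A).
Proof. by apply: subeigenpair_potential => p /A_gt0/ltW. Qed.

Lemma strict_eigenmap : unique_eigenpair A (eigenmap A).1 (eigenmap A).2.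
Proof.
apply: (strict_unique_eigenpair phi_root) => [i j|i|i j];
  rewrite slack_eigenmap.
- exact: strict_subeigenpair.
- exact: reduced_graph.
- exact: reduced_eq0.
Qed.

Lemma strict_critical_graph : generic A /\ critical_graph A phi.
Proof.
have [sub sat] := (strict_subeigenpair, saturated_potential A).
split; first exact: (strict_generic sub sat phi_root reduced_eq0).
by move=> i j; apply: (strict_critical_edge sub sat phi_root reduced_eq0).
Qed.

End Strict.

Lemma critical_graph_reduced_ge0 A p : generic A -> critical_graph A phi ->
  0 <= reduced p A.
Proof.
move=> gA cA.
have [lam [x [f [r' [sub sat fr]]]]] := exists_rooted_saturated A r.
rewrite (@reducedE _ lam x) // => i.
by apply: (critical_edge_slack sub sat fr gA); apply/cA.
Qed.

Definition graph_mx : 'M[R]_n := \matrix_(i, j) (phi i == j)%:R.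

Lemma reduced_graph_mx : {in off_graph, forall p, 0 < reduced p graph_mx}.
Proof.
move=> [i j] /negPf ij; rewrite (@reducedE _ 1 (fun=> 0)) => [|k].
  by rewrite /slack mxE ij /=; lra.
by rewrite /slack mxE eqxx /=; lra.
Qed.

Lemma Omega_rooted :
  Omega phi = [set A | {in off_graph, forall p, 0 <= reduced p A}].
Proof.
apply/seteqP; split=> A.
  move=> clA p _; apply: (closed_halfspace (l := reduced p)).
  by apply: closureS clA => B [gB cB]; apply: critical_graph_reduced_ge0.
move=> A_ge0 W /(@nbhs_line _ _ A graph_mx)[e e0 eW].
exists (A + e *: graph_mx); split; last by apply: eW; rewrite gtr0_norm.
apply: strict_critical_graph => p pP; rewrite linearD linearZ /=.
by rewrite ltr_wpDl ?A_ge0 // mulr_gt0 ?reduced_graph_mx.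
Qed.

End Eigenmap.

Section SkewSymmetric.
Context {R : realType} {n : nat}.
Implicit Types (A B : 'M[R]_n) (p : 'I_n * 'I_n) (i j : 'I_n).

Definition skew_space : {vspace 'M[R]_n} :=
  lker (linfun (idfun \+ @trmx R n n)).

Lemma skew_spaceP A : A \in skew_space <-> skew_symmetric R n A.
Proof.
rewrite memv_ker lfunE /=; split=> [/eqP/matrixP sA i j|sA].
  by have := sA i j; rewrite !mxE.
by apply/eqP/matrixP => i j; rewrite !mxE.
Qed.

Definition skew_indicator (e : rel 'I_n) : 'M[R]_n :=
  \matrix_(i, j) ((e i j)%:R - (e j i)%:R).

Lemma skew_indicator_skew e : skew_symmetric R n (skew_indicator e).
Proof. by move=> i j; rewrite !mxE; ring. Qed.

Lemma skew_symmetric_line (t : R) A B : skew_symmetric R n A ->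
  skew_symmetric R n B -> skew_symmetric R n (A + t *: B).
Proof. by rewrite -!skew_spaceP => sA sB; rewrite memvD ?memvZ. Qed.

Lemma skew_map_eq_refl (f : 'M[R]_n -> R * 'cV[R]_n) : skew_map_eq f f.
Proof. by move=> A _; split=> //; exists 0; rewrite raddf0 addr0. Qed.

Lemma skew_map_eq_sym (f g : 'M[R]_n -> R * 'cV[R]_n) :
  skew_map_eq f g -> skew_map_eq g f.
Proof. by move=> fg A /fg[-> /tp_eq_sym]. Qed.

Lemma skew_map_eq_trans (f g h : 'M[R]_n -> R * 'cV[R]_n) :
  skew_map_eq f g -> skew_map_eq g h -> skew_map_eq f h.
Proof.
move=> fg gh A sA; have [-> fgA] := fg A sA; have [-> ghA] := gh A sA.
by split=> //; apply: tp_eq_trans fgA ghA.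
Qed.

Lemma open_in_skew_sub (U : set 'M[R]_n) :
  open_in_skew U -> U `<=` skew_symmetric R n.
Proof. by case=> W _ -> A []. Qed.

Lemma open_in_skew_line (U : set 'M[R]_n) A B :
  open_in_skew U -> U A -> skew_symmetric R n B ->
  exists2 e : R, 0 < e & forall t, `|t| <= e -> U (A + t *: B).
Proof.
move=> [W oW ->] [WA sA] sB.
have [e e0 eW] := nbhs_line B (open_nbhs_nbhs (conj oW WA)).
by exists e => // t te; split; [apply: eW|apply: skew_symmetric_line].
Qed.

Lemma open_in_skewI (U U' : set 'M[R]_n) :
  open_in_skew U -> open_in_skew U' -> open_in_skew (U `&` U').
Proof.
move=> [W oW ->] [W' oW' ->]; exists (W `&` W'); first exact: openI.
by rewrite setIACA setIid.
Qed.

Lemma skew_linear_eq (U : set 'M[R]_n) f g :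
  open_in_skew U -> U !=set0 -> skew_linear f -> skew_linear g ->
  (forall A, U A -> (f A).1 = (g A).1 /\ tp_eq (f A).2 (g A).2) ->
  skew_map_eq f g.
Proof.
move=> oU [A UA] flin glin fg B sB; have sA := open_in_skew_sub oU UA.
have [e e0 eU] := open_in_skew_line oU UA sB.
have UAe : U (e *: B + A) by rewrite addrC; apply: eU; rewrite gtr0_norm.
have [[lamA [a xA]] [lamAe [b xAe]]] := (fg _ UA, fg _ UAe).
have [flam [c fx]] := flin e B A sB sA; have [glam [d gx]] := glin e B A sB sA.
have e_neq0 : e != 0 by rewrite gt_eqF.
split.
  by apply: (mulfI e_neq0); move: lamAe; rewrite flam glam lamA => /addIr.
exists ((d + b - c - a) / e); apply/colP => i; rewrite !mxE.
apply: (mulfI e_neq0); rewrite mulrDr mulrCA mulfV // mulr1.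
move/colP/(_ i): xA; move/colP/(_ i): xAe; move/colP/(_ i): fx.
by move/colP/(_ i): gx; rewrite !mxE => gE fE; rewrite fE gE; lra.
Qed.

Lemma linear_representation_unique (U : set 'M[R]_n) f g :
  open_in_skew U -> U !=set0 ->
  linear_representation U f -> linear_representation U g -> skew_map_eq f g.
Proof.
move=> oU U0 [flin fU] [glin gU]; apply: skew_linear_eq oU U0 flin glin _.
by move=> A UA; apply: unique_eigenpair_eq (fU A UA) (gU A UA).
Qed.

Lemma linear_representationS (U U' : set 'M[R]_n) f :
  U `<=` U' -> linear_representation U' f -> linear_representation U f.
Proof. by move=> UU' [flin fU']; split=> // A /UU'/fU'. Qed.

End SkewSymmetric.

Arguments skew_space R n : clear implicits.

Section KiteCones.
Context {R : realType} {n : nat}.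
Implicit Types (A B : 'M[R]_n) (i j : 'I_n) (p : 'I_n * 'I_n).

Section RootedKite.
Variables (phi : {ffun 'I_n -> 'I_n}) (r : 'I_n).
Hypothesis phi_root : rooted phi r.
Hypothesis phi_long : no_short_cycle phi.

Local Notation lam := (eigval phi r).
Local Notation red := (reduced phi r).

Lemma skew_cone_halfspace : skew_cone R phi =
  halfspace_cone (skew_space R n) (off_graph phi) (reduced phi r).
Proof.
rewrite /skew_cone (Omega_rooted phi_root).
by apply/seteqP; split=> [A [A_ge0 /skew_spaceP]|A [/skew_spaceP]].
Qed.

Lemma convex_skew_cone : convex_cone (skew_cone R phi).
Proof. by rewrite skew_cone_halfspace; apply: convex_halfspace_cone. Qed.

Lemma reduced_swap A i j : skew_symmetric R n A ->
  red (i, j) A + red (j, i) A = 2 * lam A.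
Proof. by move=> /(_ i j); rewrite /reduced /slack /=; lra. Qed.

Lemma reduced_diag A i : skew_symmetric R n A -> red (i, i) A = lam A.
Proof. by move=> sA; have := reduced_swap i i sA; lra. Qed.

Lemma skew_cone_slack A (mu : R) x : skew_symmetric R n A ->
  subeigenpair A mu x -> saturated A mu x phi -> skew_cone R phi A.
Proof.
move=> sA sub sat; rewrite skew_cone_halfspace; split; first exact/skew_spaceP.
by move=> p _; rewrite /= (reducedE phi_root sat).
Qed.

Definition kite_center : 'M[R]_n := skew_indicator (fun i j => phi i == j).

Lemma saturated_kite_center : saturated kite_center 1 (fun=> 0) phi.
Proof.
by apply/saturated0P => i; rewrite mxE eqxx (negPf (phi_long i)) subr0.
Qed.

Lemma reduced_kite_center p : red p kite_center = 1 - kite_center p.1 p.2.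
Proof. by rewrite (reducedE phi_root saturated_kite_center) /slack; ring. Qed.

Lemma kite_center_open : open_halfspace_cone (skew_space R n) (off_graph phi)
  (reduced phi r) kite_center.
Proof.
split=> [|p /negPf pP]; first exact/skew_spaceP/skew_indicator_skew.
by rewrite /= reduced_kite_center mxE pP /=; case: eqP => _ /=; lra.
Qed.

Lemma relint_skew_cone : relint (skew_cone R phi) =
  open_halfspace_cone (skew_space R n) (off_graph phi) (reduced phi r).
Proof.
by rewrite skew_cone_halfspace (relint_halfspace_cone kite_center_open).
Qed.

Lemma relint_kite_center : relint (skew_cone R phi) kite_center.
Proof. by rewrite relint_skew_cone; apply: kite_center_open. Qed.

Lemma eigenmap_representation :
  linear_representation (relint (skew_cone R phi)) (eigenmap phi r).
Proof.
split; first exact: eigenmap_skew_linear.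
by rewrite relint_skew_cone => A [_]; apply: strict_eigenmap.
Qed.

Lemma open_in_skew_relint : open_in_skew (relint (skew_cone R phi)).
Proof.
exists [set A | {in off_graph phi, forall p, 0 < reduced phi r p A}].
  exact: open_halfspaces.
rewrite relint_skew_cone.
by apply/seteqP; split=> [A [/skew_spaceP]|A [A_gt0 /skew_spaceP]].
Qed.

Lemma relint_add_center A : skew_cone R phi A ->
  forall e, 0 < e -> relint (skew_cone R phi) (A + e *: kite_center).
Proof.
rewrite relint_skew_cone skew_cone_halfspace => -[sA A0] e e0.
have [center_skew center_gt0] := kite_center_open; split=> [|p pP].
  by rewrite memvD ?memvZ.
by rewrite linearD linearZ ltr_wpDl ?A0 // mulr_gt0 ?center_gt0.
Qed.

Lemma representation_eigenmap f :
  linear_representation (relint (skew_cone R phi)) f ->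
  skew_map_eq f (eigenmap phi r).
Proof.
move=> rep; apply: linear_representation_unique rep eigenmap_representation.
  exact: open_in_skew_relint.
by exists kite_center; apply: relint_kite_center.
Qed.

Lemma linearity_cone_relint : linearity_cone (relint (skew_cone R phi)).
Proof.
split; first by exists kite_center; apply: relint_kite_center.
- exact: open_in_skew_relint.
- by rewrite relint_skew_cone; apply: convex_open_halfspace_cone.
- by exists (eigenmap phi r); apply: eigenmap_representation.
Qed.

End RootedKite.

Implicit Types phi psi : {ffun 'I_n -> 'I_n}.

Lemma relint_unique_representation phi : kite phi ->
  exists2 f, linear_representation (relint (skew_cone R phi)) f &
    forall g, linear_representation (relint (skew_cone R phi)) g ->
      skew_map_eq g f.
Proof.
case/kiteP=> r [phi_root phi_long]; exists (eigenmap phi r).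
  exact: eigenmap_representation.
exact: representation_eigenmap.
Qed.

Lemma eigenmap_inj phi r psi q :
  rooted phi r -> no_short_cycle phi -> rooted psi q ->
  skew_map_eq (eigenmap phi r) (@eigenmap R n psi q) -> phi = psi.
Proof.
move=> phi_root phi_long psi_root E; apply/ffunP => i.
have [_ center_gt0] := kite_center_open phi_root phi_long.
have [val_eq vec_eq] := E (kite_center phi) (skew_indicator_skew _).
apply: (reduced_eq0 center_gt0).
rewrite -slack_eigenmap val_eq (tp_eq_slack _ _ vec_eq) slack_eigenmap.
exact: reduced_graph.
Qed.

Lemma kite_representation_inj phi psi f g : kite phi -> kite psi ->
  linear_representation (relint (skew_cone R phi)) f ->
  linear_representation (relint (skew_cone R psi)) g ->
  skew_map_eq f g -> phi = psi.
Proof.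
case/kiteP=> r [phi_root phi_long] /kiteP[q [psi_root psi_long]] fphi gpsi fg.
apply: (eigenmap_inj phi_root phi_long psi_root).
have f_eq := representation_eigenmap phi_root phi_long fphi.
have g_eq := representation_eigenmap psi_root psi_long gpsi.
exact: skew_map_eq_trans (skew_map_eq_sym f_eq) (skew_map_eq_trans fg g_eq).
Qed.

Lemma kite_cones_cover A : (3 <= n)%N -> skew_symmetric R n A ->
  exists2 phi, kite phi & skew_cone R phi A.
Proof.
move=> n3 sA; have i0 : 'I_n := Ordinal (ltnW (ltnW n3)).
have [lam [x [f [r [sub sat fr]]]]] := exists_rooted_saturated A i0.
have [/forallP f_long|/forallPn[i]] := boolP [forall i, f (f i) != i].
  pose phi := [ffun i => f i].
  have phi_root : rooted phi r.
    by move=> i; rewrite (eq_fconnect (f' := f)) // => j; rewrite ffunE.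
  exists phi; first by apply/kiteP; exists r; split=> // i; rewrite !ffunE.
  by apply: (skew_cone_slack phi_root sA sub) => i; rewrite ffunE.
rewrite negbK => /eqP fi; have [phi kphi] := exists_kite n3; exists phi => //.
have swap i' j : slack A lam x i' j + slack A lam x j i' = 2 * lam.
  by have := sA i' j; rewrite /slack; lra.
have lam0 : lam = 0.
  by have := sat (f i); have := sat i; have := swap i (f i); rewrite fi; lra.
have [r' [phi_root' _]] := (kiteP _).1 kphi.
apply: (skew_cone_slack phi_root' sA sub) => j.
by have := swap j (phi j); have := sub j (phi j); have := sub (phi j) j; lra.
Qed.

Lemma linear_representation_sub_skew_cone phi r (U : set 'M[R]_n) f :
  rooted phi r -> open_in_skew U -> linear_representation U f ->
  skew_map_eq f (eigenmap phi r) -> U `<=` skew_cone R phi.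
Proof.
move=> phi_root oU [_ fU] fE A UA; have sA := open_in_skew_sub oU UA.
have [/eigenpairP[sub _] _] := fU A UA; have [val_eq vec_eq] := fE _ sA.
rewrite (skew_cone_halfspace phi_root); split=> [|[i j] _].
  exact/skew_spaceP.
by rewrite /= -slack_eigenmap -val_eq -(tp_eq_slack _ _ vec_eq).
Qed.

(* A point of U lies in some kite cone; pushing it towards the centre of that
   cone, it enters the interior, where the linear map is known. *)
Lemma linearity_cone_sub_relint (U : set 'M[R]_n) :
  (3 <= n)%N -> linearity_cone U ->
  exists2 phi, kite phi & U `<=` relint (skew_cone R phi).
Proof.
move=> n3 [[A UA] oU _ [f fU]]; have sA := open_in_skew_sub oU UA.
have [phi kphi phiA] := kite_cones_cover n3 sA; exists phi => //.
have [r [phi_root phi_long]] := (kiteP _).1 kphi.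
have center_line B : U B ->
    exists2 e : R, 0 < e & forall t, `|t| <= e -> U (B + t *: kite_center phi).
  by move=> UB; apply: open_in_skew_line oU UB (skew_indicator_skew _).
have fE : skew_map_eq f (eigenmap phi r).
  have rep := eigenmap_representation phi_root phi_long.
  apply: (linear_representation_unique (U := U `&` relint (skew_cone R phi))).
  - exact: open_in_skewI (open_in_skew_relint phi_root phi_long).
  - have [e e0 eU] := center_line _ UA; exists (A + e *: kite_center phi).
    by split; [apply: eU; rewrite gtr0_norm|apply: relint_add_center phiA _ e0].
  - by apply: linear_representationS fU => B [].
  - by apply: linear_representationS rep => B [].
have UC := linear_representation_sub_skew_cone phi_root oU fU fE.
move=> B UB; have [e e0 eU] := center_line _ UB.
have UBe : U (B + (- e) *: kite_center phi).
  by apply: eU; rewrite normrN gtr0_norm.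
have := relint_add_center phi_root phi_long (UC _ UBe) e0.
by rewrite scaleNr subrK.
Qed.

Lemma maximal_linearity_coneP (U : set 'M[R]_n) : (3 <= n)%N ->
  maximal_linearity_cone U <->
  exists2 phi, kite phi & U = relint (skew_cone R phi).
Proof.
move=> n3; split=> [[lU Umax]|[phi kphi ->]].
  have [phi kphi Uphi] := linearity_cone_sub_relint n3 lU; exists phi => //.
  have [r [phi_root phi_long]] := (kiteP _).1 kphi.
  by rewrite (Umax _ (linearity_cone_relint phi_root phi_long)).
have [r [phi_root phi_long]] := (kiteP _).1 kphi.
split=> [|U' lU' sub]; first exact: linearity_cone_relint phi_root phi_long.
have [psi kpsi U'psi] := linearity_cone_sub_relint n3 lU'.
have [q [psi_root psi_long]] := (kiteP _).1 kpsi.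
suff phipsi : phi = psi by apply/seteqP; split=> //; rewrite phipsi.
have rep : linear_representation (relint (skew_cone R psi)) (eigenmap psi q).
  exact: eigenmap_representation.
apply: (kite_representation_inj kphi kpsi _ rep (skew_map_eq_refl _)).
by apply: linear_representationS rep => A /sub/U'psi.
Qed.

End KiteCones.

(** * The shape of a kite cone *)

Section FreePairs.
Variables (n : nat) (phi : {ffun 'I_n -> 'I_n}).
Implicit Types (i j : 'I_n).

(* The ordered pairs whose slack is not forced by membership in the cone. *)
Definition free_pairs : {set 'I_n * 'I_n} :=
  [set p | [&& p.1 != p.2, phi p.1 != p.2 & phi p.2 != p.1]].

Definition upper_free_pairs : {set 'I_n * 'I_n} :=
  [set p in free_pairs | (p.1 < p.2)%N].

Lemma free_pairs_swap i j : ((i, j) \in free_pairs) = ((j, i) \in free_pairs).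
Proof.
by rewrite !inE /= [i == j]eq_sym [in RHS]andbCA andbA andbAC -andbA andbCA.
Qed.

Lemma free_pairs_off_graph : {subset free_pairs <= off_graph phi}.
Proof. by move=> p; rewrite inE => /and3P[]. Qed.

Lemma pair_cases i j :
  [\/ i = j, phi i = j, phi j = i | (i, j) \in free_pairs].
Proof.
rewrite inE /=; have [|_] := eqVneq i j; first by constructor 1.
have [|_] := eqVneq (phi i) j; first by constructor 2.
by have [|_] := eqVneq (phi j) i; [constructor 3|constructor 4].
Qed.

Lemma upper_free_cases i j : (i, j) \in free_pairs ->
  (i, j) \in upper_free_pairs \/ (j, i) \in upper_free_pairs.
Proof.
move=> ij; have := ij; rewrite inE => /and3P[/= ne _ _].
have [lt|gt|/val_inj E] := ltngtP i j; last by rewrite E eqxx in ne.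
  by left; rewrite inE ij.
by right; rewrite inE -free_pairs_swap ij.
Qed.

Lemma card_upper_free_pairs : (#|upper_free_pairs| * 2 = #|free_pairs|)%N.
Proof.
rewrite -(cardsID [set p : 'I_n * 'I_n | (p.1 < p.2)%N] free_pairs).
have -> : free_pairs :&: [set p : 'I_n * 'I_n | (p.1 < p.2)%N] =
          upper_free_pairs.
  by apply/setP => p; rewrite !inE.
have -> : free_pairs :\: [set p : 'I_n * 'I_n | (p.1 < p.2)%N] =
          [set (p.2, p.1) | p in upper_free_pairs]%SET.
  apply/setP => -[i j]; rewrite finset.in_setD inE /=; apply/andP/imsetP.
    rewrite -leqNgt => -[ji ij]; exists (j, i) => //.
    rewrite inE free_pairs_swap ij /= ltn_neqAle ji andbT eq_sym.
    by move: ij; rewrite inE => /and3P[].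
  case=> -[j' i'] /[swap] [[-> ->]] /=; rewrite inE /= => /andP[ij lt].
  by rewrite -leqNgt free_pairs_swap ij ltnW.
rewrite card_imset; last by move=> [? ?] [? ?] [-> ->].
by rewrite addnn muln2.
Qed.

Hypothesis phi_long : no_short_cycle phi.

Lemma card_free_pairs : #|free_pairs| = (n * (n - 3))%N.
Proof.
have one_case i j :
    ((i == j) + (phi i == j) + (phi j == i) + ((i, j) \in free_pairs) = 1)%N.
  rewrite inE /=; have [<-|ij] := eqVneq i j.
    suff /negPf -> : phi i != i by [].
    by apply: contraNneq (phi_long i) => ii; rewrite !ii.
  have [<-|_] := eqVneq (phi i) j; first by rewrite (negPf (phi_long i)).
  by case: (_ == i).
have card_graph (f : 'I_n -> 'I_n) : (\sum_i \sum_j (f i == j) = n)%N.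
  rewrite -[RHS]card_ord -sum1_card; apply: eq_bigr => i _.
  by rewrite (bigD1 (f i)) //= eqxx big1 // => j /negPf; rewrite eq_sym => ->.
have card_sum : (#|free_pairs| = \sum_i \sum_j ((i, j) \in free_pairs))%N.
  rewrite -sum1_card big_mkcond pair_bigA; apply: eq_bigr => -[i j] _ /=.
  by case: (_ \in _).
have : (\sum_i \sum_j ((i == j) + (phi i == j) + (phi j == i)
    + ((i, j) \in free_pairs)) = n * n)%N.
  under eq_bigr do under eq_bigr do rewrite one_case.
  by rewrite pair_bigA /= sum1_card card_prod !card_ord.
under eq_bigr do rewrite !big_split /=.
rewrite !big_split /= (card_graph id) (card_graph phi) -card_sum.
rewrite [X in (_ + X + _)%N]exchange_big /= (card_graph phi) mulnBr.
by lia.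
Qed.

End FreePairs.

Section Coordinates.
Context {R : realType} {n : nat}.
Variables (phi : {ffun 'I_n -> 'I_n}) (r : 'I_n).
Hypothesis phi_root : rooted phi r.
Hypothesis phi_long : no_short_cycle phi.
Implicit Types (A B : 'M[R]_n) (i j : 'I_n) (p q : 'I_n * 'I_n).

Local Notation lam := (eigval phi r).
Local Notation pot := (potential phi r).
Local Notation red := (reduced phi r).
Local Notation center := (kite_center phi).

Lemma skew_cone_freeP A : skew_symmetric R n A ->
  skew_cone R phi A <->
  0 <= lam A /\ {in free_pairs phi, forall p, 0 <= red p A}.
Proof.
move=> sA; rewrite (skew_cone_halfspace phi_root); split=> [[_ A_ge0]|[l0 f0]].
  split=> [|p /free_pairs_off_graph/A_ge0//].
  have phi_r : (phi r, r) \in off_graph phi by apply: phi_long.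
  have := reduced_swap phi r r (phi r) sA; rewrite reduced_graph // add0r => E.
  by have := A_ge0 _ phi_r; rewrite /= E pmulr_rge0.
split=> [|[i j] _]; first exact/skew_spaceP.
case: (pair_cases phi i j) => [<-|<-|<-|/f0//] /=.
- by rewrite reduced_diag.
- by rewrite reduced_graph.
- by have := reduced_swap phi r j (phi j) sA; rewrite reduced_graph //; lra.
Qed.

Definition skew_delta p : 'M[R]_n :=
  skew_indicator (fun i j => (i, j) == p).

Lemma saturated_skew_delta p : p \in free_pairs phi ->
  saturated (skew_delta p) 0 (fun=> 0) phi.
Proof.
case: p => a b; rewrite inE => /and3P[/= ab pab pba]; apply/saturated0P => i.
rewrite mxE !xpair_eqE; have [->|_] /= := eqVneq i a.
  by rewrite (negPf pab) (negPf ab) andbF subrr.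
by have [->|_] /= := eqVneq i b; rewrite ?(negPf pba) ?andbF subrr.
Qed.

Lemma reduced_skew_delta p q : p \in free_pairs phi ->
  red q (skew_delta p) = - skew_delta p q.1 q.2.
Proof.
move=> pf; rewrite (reducedE phi_root (saturated_skew_delta pf)) /slack; ring.
Qed.

Lemma reduced_kite_center_free p :
  p \in free_pairs phi -> red p center = 1 :> R.
Proof.
rewrite inE => /and3P[_ /negPf p12 /negPf p21].
by rewrite (reduced_kite_center phi_root phi_long) mxE p12 p21 subrr subr0.
Qed.

Lemma skew_delta_self p : p.1 != p.2 -> skew_delta p p.1 p.2 = 1.
Proof.
case: p => i j /= /negPf ij.
by rewrite mxE eqxx xpair_eqE [j == i]eq_sym ij subr0.
Qed.

Lemma skew_delta_le0 p q : q != p -> skew_delta p q.1 q.2 <= 0.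
Proof.
by rewrite mxE -surjective_pairing => /negPf ->; rewrite sub0r oppr_le0.
Qed.

Lemma skew_delta_upper p q :
  p \in upper_free_pairs phi -> q \in upper_free_pairs phi ->
  skew_delta p q.1 q.2 = (q == p)%:R.
Proof.
rewrite !inE mxE -surjective_pairing => /andP[_ p_up] /andP[_ q_up].
rewrite (_ : (_, _) == p = false) ?subr0 //; apply: contraTF p_up => /eqP <-.
by rewrite -leqNgt ltnW.
Qed.

Lemma skew_cone_free_halfspace : (0 < #|free_pairs phi|)%N -> skew_cone R phi =
  halfspace_cone (skew_space R n) (free_pairs phi) (reduced phi r).
Proof.
case/card_gt0P=> -[i j] ij; apply/seteqP; split=> A.
  move=> CA; have [_ sA] := CA; split; first exact/skew_spaceP.
  by have [_] := (skew_cone_freeP sA).1 CA.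
move=> [/skew_spaceP sA f0]; apply/(skew_cone_freeP sA); split=> //.
have ji : (j, i) \in free_pairs phi by rewrite free_pairs_swap.
have := f0 _ ij; have := f0 _ ji; have := reduced_swap phi r i j sA.
by move=> /=; lra.
Qed.

Lemma irredundant_free_pairs : {in free_pairs phi, forall p, exists A,
  [/\ A \in skew_space R n, red p A = 0 &
    {in free_pairs phi, forall q, q != p -> 0 < red q A}]}.
Proof.
move=> p pf; exists (center + skew_delta p).
have redE q : q \in free_pairs phi ->
    red q (center + skew_delta p) = 1 - skew_delta p q.1 q.2.
  move=> qf; rewrite linearD /= reduced_kite_center_free //.
  by rewrite reduced_skew_delta.
split=> [||q qf qp].
- by rewrite memvD //; apply/skew_spaceP/skew_indicator_skew.
- rewrite redE // skew_delta_self ?subrr //.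
  by move: pf; rewrite inE => /and3P[].
- by rewrite redE //; have := skew_delta_le0 qp; lra.
Qed.

Local Notation vertices := [set~ r]%SET.
Local Notation pairs := (upper_free_pairs phi).

Definition kite_coords A :
    ('rV[R]_#|vertices| * (R^o * 'rV[R]_#|pairs|))%type :=
  (\row_k pot (enum_val k) A, (lam A, \row_k (lam A - red (enum_val k) A))).

Lemma kite_coords_linear : linear kite_coords.
Proof.
move=> a A B; rewrite /kite_coords; congr (_, (_, _)).
- by apply/rowP => k; rewrite !mxE linearP.
- exact: linearP.
- apply/rowP => k; rewrite !mxE !linearP /=.
  by rewrite /GRing.scale /=; ring.
Qed.

HB.instance Definition _ := GRing.isLinear.Build R 'M[R]_n
  ('rV[R]_#|vertices| * (R^o * 'rV[R]_#|pairs|))%type *:%R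
  kite_coords kite_coords_linear.

Lemma kite_coords_eq0 A : skew_symmetric R n A -> kite_coords A = 0 -> A = 0.
Proof.
move=> sA [/rowP pot0 lam0 /rowP red0].
have potA i : pot i A = 0.
  have [->|ir] := eqVneq i r; first exact: potential_root.
  have iv : i \in vertices by rewrite !inE.
  by have := pot0 (enum_rank_in iv i); rewrite !mxE enum_rankK_in.
have redA_upper p : p \in pairs -> red p A = 0.
  move=> pP; have := red0 (enum_rank_in pP p).
  by rewrite !mxE enum_rankK_in // lam0 sub0r => /eqP; rewrite oppr_eq0 => /eqP.
have redA i j : red (i, j) A = 0.
  have := reduced_swap phi r i j sA; rewrite lam0.
  case: (pair_cases phi i j) => [<-|<-|<-|/upper_free_cases[/redA_upper//|]].
  - by rewrite reduced_diag.
  - by rewrite reduced_graph.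
  - by rewrite (reduced_graph phi_root A j) addr0 mulr0.
  - by move=> /redA_upper ->; rewrite addr0 mulr0.
apply/matrixP => i j; have := redA i j.
by rewrite /reduced /slack lam0 !potA mxE; lra.
Qed.

Section KiteMatrix.
Variables (t : R) (u : 'rV[R]_#|pairs|).

Definition kite_mx : 'M[R]_n :=
  t *: center + \sum_k u 0 k *: skew_delta (enum_val k).

Lemma kite_mxE i j : kite_mx i j =
  t * center i j + \sum_k u 0 k * skew_delta (enum_val k) i j.
Proof. by rewrite mxE [in LHS]mxE summxE; under eq_bigr do rewrite mxE. Qed.

Lemma kite_mx_skew : skew_symmetric R n kite_mx.
Proof.
apply/skew_spaceP; rewrite memvD ?memvZ //.
  exact/skew_spaceP/skew_indicator_skew.
apply: memv_suml => k _; rewrite memvZ //.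
exact/skew_spaceP/skew_indicator_skew.
Qed.

Lemma kite_mx_graph i : kite_mx i (phi i) = t.
Proof.
rewrite kite_mxE ((saturated0P _ _ _).1 (saturated_kite_center phi_long)) mulr1.
rewrite big1 ?addr0 // => k _; have := enum_valP k; rewrite inE => /andP[kf _].
by rewrite ((saturated0P _ _ _).1 (saturated_skew_delta kf)) mulr0.
Qed.

Lemma kite_mx_upper k : kite_mx (enum_val k).1 (enum_val k).2 = u 0 k.
Proof.
rewrite kite_mxE (bigD1 k) //= skew_delta_upper ?enum_valP // eqxx mulr1.
rewrite big1 => [|l lk]; last first.
  rewrite skew_delta_upper ?enum_valP // (inj_eq enum_val_inj) eq_sym.
  by rewrite (negPf lk) mulr0.
have := enum_valP k; rewrite !inE mxE => /andP[/and3P[_ /negPf -> /negPf ->] _].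
by rewrite subrr mulr0 add0r addr0.
Qed.

End KiteMatrix.

Lemma kite_coords_surj x t u :
  exists2 A, skew_symmetric R n A & kite_coords A = (x, (t, u)).
Proof.
pose y i := \sum_(k < #|vertices|) x 0 k * (enum_val k == i)%:R.
have y_val k : y (enum_val k) = x 0 k.
  rewrite /y (bigD1 k) //= eqxx big1 ?addr0 ?mulr1 // => l lk.
  by rewrite (inj_eq enum_val_inj) (negPf lk) mulr0.
have y_r : y r = 0.
  rewrite /y big1 // => k _; have := enum_valP k.
  by rewrite !inE => /negPf ->; rewrite mulr0.
pose A := \matrix_(i, j) (y i - y j + kite_mx t u i j).
have sat : saturated A t y phi.
  by move=> i; rewrite /slack mxE kite_mx_graph; ring.
exists A.
  by move=> i j; rewrite ![A _ _]mxE; have := kite_mx_skew t u i j; lra.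
rewrite /kite_coords (eigvalE phi_root sat); congr (_, (_, _)); apply/rowP => k.
  by rewrite mxE (potentialE phi_root sat) y_val y_r subr0.
by rewrite mxE (reducedE phi_root sat) /slack mxE kite_mx_upper; ring.
Qed.

Lemma kite_coords_bij : set_bij (skew_symmetric R n) setT kite_coords.
Proof.
split=> // [A B|[x [t u]] _]; last first.
  by have [A sA <-] := kite_coords_surj x t u; exists A.
rewrite !inE -!skew_spaceP => sA sB AB; apply/subr0_eq/kite_coords_eq0.
  by apply/skew_spaceP/memvB.
by rewrite linearB /= AB subrr.
Qed.

Lemma skew_cone_kite_coordsP A : skew_symmetric R n A ->
  skew_cone R phi A <->
  cone_over (standard_cube R #|pairs|) (kite_coords A).2.
Proof.
move=> sA; rewrite skew_cone_freeP // cone_over_cubeP /=.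
have swap i j := reduced_swap phi r i j sA.
split=> [[l0 f0]|[l0 cube]]; split=> //.
  move=> k; have := enum_valP k; rewrite mxE inE.
  case: (enum_val k) => i j /andP[/[dup] ij]; rewrite free_pairs_swap => ji _.
  by rewrite ler_norml; have := f0 _ ij; have := f0 _ ji; have := swap i j; lra.
have upper i j : (i, j) \in pairs -> 0 <= red (i, j) A /\ 0 <= red (j, i) A.
  move=> ij; have := cube (enum_rank_in ij (i, j)).
  by rewrite mxE enum_rankK_in // ler_norml; have := swap i j; lra.
by move=> [i j] /upper_free_cases[/upper[]|/upper[]].
Qed.

Lemma kite_coords_image : kite_coords @` skew_cone R phi =
  setT `*` cone_over (standard_cube R #|pairs|).
Proof.
apply/seteqP; split=> [_ [A CA <-]|[x [t u]] [_ /= cube]].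
  by split=> //; apply/skew_cone_kite_coordsP => //; case: CA.
have [A sA EA] := kite_coords_surj x t u; exists A => //.
by apply/skew_cone_kite_coordsP; rewrite // EA.
Qed.

End Coordinates.

Lemma bin2_subn n : (3 <= n)%N -> (n * (n - 3) %/ 2 = 'C(n, 2) - n)%N.
Proof.
move=> n3; rewrite bin2 -divn2; have -> : (n * n.-1 = n * (n - 3) + n * 2)%N.
  by rewrite -mulnDr; congr (_ * _)%N; lia.
by rewrite addnC divnMDl // addKn.
Qed.

Section KiteConeShape.
Variables (R : realType) (n : nat) (phi : {ffun 'I_n -> 'I_n}).
Hypothesis kphi : kite phi.

Lemma kite_cone_isomorphism :
  exists f : {linear 'M[R]_n ->
               ('rV[R]_(n - 1) * (R^o * 'rV[R]_((n * (n - 3)) %/ 2)))%type},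
    set_bij (skew_symmetric R n) setT f /\
    f @` skew_cone R phi =
      setT `*` cone_over (standard_cube R ((n * (n - 3)) %/ 2)).
Proof.
case/kiteP: kphi => r [phi_root phi_long].
have <- : #|[set~ r]%SET| = (n - 1)%N by rewrite cardsC1 card_ord subn1.
have <- : #|upper_free_pairs phi| = (n * (n - 3) %/ 2)%N.
  by rewrite -(card_free_pairs phi_long) -card_upper_free_pairs mulnK.
exists (kite_coords phi r); split; first exact: kite_coords_bij.
exact: kite_coords_image.
Qed.

Hypothesis n_ge4 : (4 <= n)%N.

Lemma kite_cone_not_simplicial : ~ simplicial_cone (skew_cone R phi).
Proof.
move=> /simplicial_riesz_refinement refine.
have [r [phi_root _]] := (kiteP _).1 kphi.
have [_ coneD] := convex_skew_cone (R := R) phi_root.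
have [f [[_ f_inj _] f_image]] := kite_cone_isomorphism.
have cone_inj : {in skew_cone R phi &, injective f}.
  by apply: sub_in2 f_inj => A; rewrite !inE => -[].
have half_ge2 : (2 <= n * (n - 3) %/ 2)%N by rewrite leq_divRL //; nia.
apply: (@cube_cone_not_riesz R 'rV[R]_(n - 1) _ half_ge2); rewrite -f_image.
exact: riesz_refinement_image (linearD f) coneD cone_inj refine.
Qed.

Lemma card_kite_cone_facets :
  ([set F | facet (skew_cone R phi) F] #= `I_(n * (n - 3)))%card.
Proof.
have [r [phi_root phi_long]] := (kiteP _).1 kphi.
have free_gt0 : (0 < #|free_pairs phi|)%N.
  by rewrite (card_free_pairs phi_long); nia.
rewrite (skew_cone_free_halfspace phi_root phi_long free_gt0).
rewrite -(card_free_pairs phi_long).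
apply: (card_facets_halfspace_cone (c := kite_center phi)).
  have [center_skew center_gt0] := kite_center_open (R := R) phi_root phi_long.
  by split=> // p /free_pairs_off_graph/center_gt0.
exact: irredundant_free_pairs.
Qed.

End KiteConeShape.

(** * Two kite cones that do not meet in a common face *)

Section NotFan.
Context {R : realType} {n : nat}.
Hypothesis n_ge6 : (6 <= n)%N.

Definition next012 (k : nat) : nat :=
  match k with
  | 0 => 1 | 1 => 2 | 2 => 0 | 3 => 4 | 4 => 5 | _ => 0
  end%N.

Definition next345 (k : nat) : nat :=
  match k with
  | 0 => 1 | 1 => 2 | 2 => 3 | 3 => 4 | 4 => 5 | 5 => 3 | _ => 0
  end%N.

Lemma next012_lt k : (next012 k < n)%N.
Proof. by apply: leq_trans n_ge6; case: k => [|[|[|[|[|[|k]]]]]]. Qed.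

Lemma next345_lt k : (next345 k < n)%N.
Proof. by apply: leq_trans n_ge6; case: k => [|[|[|[|[|[|k]]]]]]. Qed.

Definition phi012 : {ffun 'I_n -> 'I_n} := ord_fun next012_lt.
Definition phi345 : {ffun 'I_n -> 'I_n} := ord_fun next345_lt.

Lemma kite_phi012 : kite phi012.
Proof.
apply: (@kite_ord_fun _ _ _ 0); first exact: leq_trans n_ge6.
  by case=> [|[|[|[|[|[|k]]]]]]; [exists 0|exists 2|exists 1|exists 3|exists 2
    |exists 1|exists 1].
by case=> [|[|[|[|[|[|k]]]]]].
Qed.

Lemma kite_phi345 : kite phi345.
Proof.
apply: (@kite_ord_fun _ _ _ 3); first exact: leq_trans n_ge6.
  by case=> [|[|[|[|[|[|k]]]]]]; [exists 3|exists 2|exists 1|exists 0|exists 2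
    |exists 1|exists 4].
by case=> [|[|[|[|[|[|k]]]]]].
Qed.

Definition triangles_mx : 'M[R]_n :=
  skew_indicator
    (fun i j => (next012 i == j) || (i == 5 :> nat) && (j == 3 :> nat)).

Definition bridge_mx : 'M[R]_n :=
  skew_indicator (fun i j => (i == 2 :> nat) && (j == 3 :> nat)).

Lemma skew_cone_phi012 t : -1 <= t <= 1 ->
  skew_cone R phi012 (triangles_mx + t *: bridge_mx).
Proof.
move=> t1; have [r [phi_root _]] := (kiteP _).1 kite_phi012.
apply: (@skew_cone_slack _ _ _ _ phi_root _ 1 (fun=> 0)).
- by apply: skew_symmetric_line; apply: skew_indicator_skew.
- move=> [i i_lt] [j j_lt]; rewrite /slack !mxE /=; move: i j {i_lt j_lt}.
  by case=> [|[|[|[|[|[|i]]]]]]; case=> [|[|[|[|[|[|j]]]]]] /=; lra.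
- apply/saturated0P => -[i i_lt]; rewrite ffunE !mxE /=; move: i {i_lt}.
  by case=> [|[|[|[|[|[|i]]]]]] /=; lra.
Qed.

Definition potential345 (i : 'I_n) : R := (3 <= i <= 5)%N%:R.

Lemma saturated_triangles_mx : saturated triangles_mx 1 potential345 phi345.
Proof.
move=> [i i_lt]; rewrite ffunE /slack !mxE /potential345 /=; move: i {i_lt}.
by case=> [|[|[|[|[|[|i]]]]]] /=; lra.
Qed.

Lemma skew_cone_phi345 : skew_cone R phi345 triangles_mx.
Proof.
have [r [psi_root _]] := (kiteP _).1 kite_phi345.
apply: (skew_cone_slack psi_root _ _ saturated_triangles_mx).
  exact: skew_indicator_skew.
move=> [i i_lt] [j j_lt]; rewrite /slack !mxE /potential345 /=.
move: i j {i_lt j_lt}.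
by case=> [|[|[|[|[|[|i]]]]]]; case=> [|[|[|[|[|[|j]]]]]] /=; lra.
Qed.

(* The edge 0 -> 3 has slack 0 at triangles_mx and slack 1 at bridge_mx. *)
Lemma not_skew_cone_phi345 t : t < 0 ->
  ~ skew_cone R phi345 (triangles_mx + t *: bridge_mx).
Proof.
move=> t0; have [r [psi_root _]] := (kiteP _).1 kite_phi345.
pose i0 : 'I_n := Ordinal (leq_trans (isT : 0 < 6)%N n_ge6).
pose i3 : 'I_n := Ordinal (leq_trans (isT : 3 < 6)%N n_ge6).
have sat_bridge : saturated bridge_mx 0 (fun i => - potential345 i) phi345.
  move=> [i i_lt]; rewrite ffunE /slack !mxE /potential345 /=; move: i {i_lt}.
  by case=> [|[|[|[|[|[|i]]]]]] /=; lra.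
rewrite (skew_cone_halfspace psi_root) => -[_ /(_ (i0, i3))].
rewrite inE -val_eqE ffunE /= => /(_ isT).
rewrite linearD linearZ /= (reducedE psi_root saturated_triangles_mx).
rewrite (reducedE psi_root sat_bridge) /slack !mxE /potential345 /=.
rewrite /GRing.scale /=; lra.
Qed.

(* triangles_mx lies in both cones and is the midpoint of two points of the cone
   of phi012, one of which lies outside the cone of phi345. *)
Lemma kite_cones_not_fan : ~ fan (all_faces (kite_cones R n)).
Proof.
move=> is_fan.
have mem phi : kite phi -> all_faces (kite_cones R n) (skew_cone R phi).
  move=> kphi; exists (skew_cone R phi); last exact: face_refl.
  by exists phi.
have [r [psi_root _]] := (kiteP _).1 kite_phi345.
pose A t := triangles_mx + t *: bridge_mx.
apply: (@not_skew_cone_phi345 (-1)); first by rewrite ltrN10.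
have [mem012 mem345] := (mem _ kite_phi012, mem _ kite_phi345).
apply: (fan_absorbs (v := A 1) is_fan mem012 mem345).
- by apply: skew_cone_phi012; lra.
- by apply: skew_cone_phi012; lra.
have -> : triangles_mx + (-1) *: bridge_mx + A 1 = triangles_mx + triangles_mx.
  by rewrite /A scaleN1r scale1r addrACA addNr addr0.
have [_ coneD] := convex_skew_cone (R := R) psi_root.
by apply: coneD; apply: skew_cone_phi345.
Qed.

End NotFan.

Theorem theorem4p1 (R : realType) (n : nat) (n_ge3 : (3 <= n)%N) :
  [/\ (* the maximal open cones of linearity are those given by kites *)
      (forall U : set 'M[R]_n,
         maximal_linearity_cone U <->
         exists2 phi, kite phi & U = relint (skew_cone R phi)),
      (* the linear functions are unique and distinct *)
      (forall phi : {ffun 'I_n -> 'I_n}, kite phi ->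
         exists2 f, linear_representation (relint (skew_cone R phi)) f &
           forall g, linear_representation (relint (skew_cone R phi)) g ->
             skew_map_eq g f) /\
      (forall (phi psi : {ffun 'I_n -> 'I_n}) f g,
         kite phi -> kite psi ->
         linear_representation (relint (skew_cone R phi)) f ->
         linear_representation (relint (skew_cone R psi)) g ->
         skew_map_eq f g -> phi = psi),
      (* facets *)
      (forall phi : {ffun 'I_n -> 'I_n}, kite phi -> (4 <= n)%N ->
         ([set F | facet (skew_cone R phi) F] #= `I_(n * (n - 3)))%card /\
         ~ simplicial_cone (skew_cone R phi)),
      (* R^(n-1) times the cone over the cube of dimension n(n-3)/2 *)
      ((n * (n - 3)) %/ 2 = 'C(n, 2) - n)%N /\
      (forall phi : {ffun 'I_n -> 'I_n}, kite phi ->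
         exists f : {linear 'M[R]_n ->
                      ('rV[R]_(n - 1) * (R^o * 'rV[R]_((n * (n - 3)) %/ 2)))%type},
           set_bij (skew_symmetric R n) setT f /\
           f @` skew_cone R phi =
             setT `*` cone_over (standard_cube R ((n * (n - 3)) %/ 2))) &
      (* not a fan *)
      ((6 <= n)%N -> ~ fan (all_faces (kite_cones R n)))].
Proof.
split.
- by move=> U; apply: maximal_linearity_coneP.
- split=> [phi|phi psi f g]; first exact: relint_unique_representation.
  exact: kite_representation_inj.
- move=> phi kphi n_ge4; split; first exact: card_kite_cone_facets.
  exact: kite_cone_not_simplicial.
- by split=> [|phi]; [apply: bin2_subn|apply: kite_cone_isomorphism].
- exact: kite_cones_not_fan.
Qed.
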